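(* Let $\theta\in[0,1]$, let $p>1$ if $n\in\{1,2\}$ and $1<p<\frac{n+2}{n-2}$ if $n\ge 3$; if $n\ge3$, assume in addition $$1<p\le\frac{n+2\theta}{n-2}.$$ Let $(u_0,u_1)\in H_0^1(\Omega)\times L^2(\Omega)$ with $(u_0,u_1)\ne(0,0)$, and let $u$ be an energy solution of the initial--boundary value problem (P) (described in the context) with initial data $(u_0,u_1)$ on $[0,T_{\max})$. Then $$T_{\max}\ \ge\ \frac{1}{(p-1)\,K_{p,\theta}\,\Phi(0)^{p-1}},\qquad \Phi(0)=\|u_1\|^2+\|\nabla u_0\|^2,$$ where $K_{p,\theta}:=\frac12S_\theta^2B_{p,\theta}^{2p}$ and, for $n\ge3$, with $q_\theta:=\frac{2n}{n-2\theta}$ and $q_\theta':=\frac{2n}{n+2\theta}$, $$S_\theta:=\sup_{0\ne v\in D(A^{\theta/2})}\frac{\|v\|_{q_\theta}}{\|A^{\theta/2}v\|},\qquad B_{p,\theta}:=\sup_{0\ne v\in H_0^1(\Omega)}\frac{\|v\|_{pq_\theta'}}{\|\nabla v\|}.$$ For $n\le2$ the same conclusion holds for every $p>1$, with $q_\theta:=2$ and $q_\theta':=2$ in the definitions of $S_\theta$ and $B_{p,\theta}$, in which case $S_\theta=\lambda_1^{-\theta/2}$.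
   Context: Let $\Omega\subset\mathbb{R}^n$, $n\ge1$, be a bounded open set (no boundary regularity is assumed). All functions are real-valued. $(\cdot,\cdot)$ is the inner product of $L^2(\Omega)$, $\|\cdot\|_q$ the norm of $L^q(\Omega)$, $\|\cdot\|:=\|\cdot\|_2$, and $\langle\cdot,\cdot\rangle$ the duality pairing between $H^{-1}(\Omega)$ and $H_0^1(\Omega)$. $A:=-\Delta$ with Dirichlet boundary conditions, with eigenpairs $(\lambda_k,e_k)_{k\ge1}$, $0<\lambda_1\le\lambda_2\le\cdots$, $(e_k)$ an orthonormal basis of $L^2(\Omega)$. For $s\ge0$, $A^sv=\sum_k\lambda_k^s(v,e_k)e_k$ on $D(A^s)=\{v\in L^2(\Omega):\sum_k\lambda_k^{2s}(v,e_k)^2<\infty\}$; thus $D(A^{1/2})=H_0^1(\Omega)$, $\|A^{1/2}v\|=\|\nabla v\|$, $A^0=\mathrm{Id}$, and $H_0^1(\Omega)\subset D(A^{\theta/2})$ for $\theta\in[0,1]$. Problem (P): $u_{tt}+A^\theta u_t-\Delta u=|u|^{p-1}u$ in $\Omega\times(0,T)$, $u=0$ on $\partial\Omega\times(0,T)$, $u(\cdot,0)=u_0$, $u_t(\cdot,0)=u_1$ in $\Omega$. Functionals: $E(t):=\frac12\|u_t(t)\|^2+\frac12\|\nabla u(t)\|^2-\frac1{p+1}\|u(t)\|_{p+1}^{p+1}$; $\Phi(t):=\|u_t(t)\|^2+\|\nabla u(t)\|^2$. Energy solution: for $T\in(0,\infty]$, $u$ is an energy solution of (P) on $[0,T)$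 if (S1) $u\in C([0,T);H_0^1(\Omega))\cap C^1([0,T);L^2(\Omega))$ and $u_t\in L^2_{\mathrm{loc}}([0,T);D(A^{\theta/2}))$; (S2) $u(0)=u_0$, $u_t(0)=u_1$, $u_{tt}\in L^2_{\mathrm{loc}}([0,T);H^{-1}(\Omega))$ and $\langle u_{tt},v\rangle+(A^{\theta/2}u_t,A^{\theta/2}v)+(\nabla u,\nabla v)=\langle|u|^{p-1}u,v\rangle$ for a.e. $t\in(0,T)$ and all $v\in H_0^1(\Omega)$ (where $\langle|u|^{p-1}u,v\rangle=\int_\Omega|u|^{p-1}uv\,\mathrm{d}x$); (S3) $E(t)+\int_0^t\|A^{\theta/2}u_s(s)\|^2\,\mathrm{d}s\le E(0)$ for all $t\in[0,T)$; (S4) $T$ is maximal in the sense that either $T=\infty$, or $T<\infty$ and $\limsup_{t\to T^-}\Phi(t)=+\infty$. One then writes $T=T_{\max}\in(0,\infty]$. *)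

(* Defs.v *)
From HB Require Import structures.
From mathcomp Require Import all_boot all_order all_algebra.
From mathcomp Require Import all_classical all_reals all_analysis.

Set Implicit Arguments.
Unset Strict Implicit.
Unset Printing Implicit Defensive.

Import Order.TTheory GRing.Theory Num.Theory.
Import numFieldNormedType.Exports.

Local Open Scope classical_set_scope.
Local Open Scope ring_scope.

(* The sigma-algebra of R^n generated by the coordinates, i.e. the Borel
   sigma-algebra. *)
Definition rV_display : measure_display -> measure_display.
Proof. exact. Qed.

Section measurable_rV.
Context {R : realType} (n : nat).

Let coords : 'I_n -> 'rV[R]_n -> R := fun i x => x ord0 i.

Let rV_set0 : g_sigma_preimage coords set0.
Proof. exact: sigma_algebra0. Qed.

Let rV_setC A : g_sigma_preimage coords A -> g_sigma_preimage coords (~` A).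
Proof. exact: sigma_algebraC. Qed.

Let rV_bigcup (F : (set 'rV[R]_n)^nat) :
  (forall i, g_sigma_preimage coords (F i)) ->
  g_sigma_preimage coords (\bigcup_i (F i)).
Proof. exact: sigma_algebra_bigcup. Qed.

HB.instance Definition _ := @isMeasurable.Build (rV_display default_measure_display)
  'rV[R]_n (g_sigma_preimage coords) rV_set0 rV_setC rV_bigcup.

End measurable_rV.

Lemma measurable_coord (R : realType) n (i : 'I_n) :
  measurable_fun [set: 'rV[R]_n] (fun x => x ord0 i).
Proof.
move=> _ Y mY; rewrite setTI; apply: sub_sigma_algebra => /=.
rewrite -bigcup_seq/=; exists i => /=; first by rewrite mem_index_enum.
by exists Y => //; rewrite setTI.
Qed.

Lemma measurable_fun_coordP d (T : measurableType d) (R : realType) n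
    (f : T -> 'rV[R]_n) :
  (forall i, measurable_fun [set: T] (fun x => f x ord0 i)) ->
  measurable_fun [set: T] f.
Proof.
move=> mf; move=> _ A mA; rewrite setTI.
pose C : set (set 'rV[R]_n) := [set A | measurable (f @^-1` A)].
suff: @measurable _ 'rV[R]_n `<=` C by exact.
apply: smallest_sub; first split.
- by rewrite /C /= preimage_set0.
- by move=> B; rewrite /C /= setTD preimage_setC; exact: measurableC.
- by move=> F mF; rewrite /C /= preimage_bigcup; exact: bigcupT_measurable.
- rewrite -bigcup_seq => B [i _ [D mD <-]]; rewrite /C /= setTI.
  by have := mf i measurableT D mD; rewrite setTI.
Qed.

Section lebesgue_cons.
Context {R : realType} (n : nat) (mu : {sigma_finite_measure set 'rV[R]_n -> \bar R}).

Definition rVcons (z : R * 'rV[R]_n) : 'rV[R]_n.+1 :=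
  row_mx (z.1)%:M z.2 : 'rV[R]_(1 + n).

Lemma rVcons0 z : rVcons z ord0 ord0 = z.1.
Proof.
rewrite /rVcons mxE; case: splitP => [j _|[]//].
by rewrite [j]ord1 !mxE ?eqxx ?mulr1n.
Qed.

Lemma rVconsS z i : rVcons z ord0 (lift ord0 i) = z.2 ord0 i.
Proof.
rewrite /rVcons mxE; case: splitP => [[[]//]|k] /= ik.
by congr (z.2 _ _); apply: val_inj; case: ik.
Qed.

Lemma measurable_rVcons : measurable_fun setT rVcons.
Proof.
apply: measurable_fun_coordP => i; case: (unliftP ord0 i) => [j ->|->].
- under eq_fun do rewrite rVconsS.
  exact: (measurableT_comp (measurable_coord j) measurable_snd).
- by under eq_fun do rewrite rVcons0; exact: measurable_fst.
Qed.

Definition lebesgue_cons : set 'rV[R]_n.+1 -> \bar R :=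
  pushforward (@lebesgue_measure R \x mu)%E rVcons.

Let preimage_rVcons A : measurable A -> measurable (rVcons @^-1` A).
Proof. by move=> mA; rewrite -[X in measurable X]setTI; exact: measurable_rVcons. Qed.

Let lebesgue_cons0 : lebesgue_cons set0 = 0%E.
Proof. by rewrite /lebesgue_cons /pushforward preimage_set0 measure0. Qed.

Let lebesgue_cons_ge0 A : (0 <= lebesgue_cons A)%E.
Proof. by rewrite /lebesgue_cons /pushforward measure_ge0. Qed.

Let lebesgue_cons_sigma_additive : semi_sigma_additive lebesgue_cons.
Proof.
move=> F mF tF mUF; rewrite /lebesgue_cons /pushforward preimage_bigcup.
apply: measure_semi_sigma_additive.
- by move=> k; exact: preimage_rVcons.
- apply/trivIsetP => /= i j _ _ ij; rewrite -preimage_setI.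
  by move/trivIsetP : tF => /(_ _ _ _ _ ij) ->//; rewrite preimage_set0.
- by rewrite -preimage_bigcup; exact: preimage_rVcons.
Qed.

HB.instance Definition _ := isMeasure.Build _ _ _ lebesgue_cons
  lebesgue_cons0 lebesgue_cons_ge0 lebesgue_cons_sigma_additive.

Let rVuncons (x : 'rV[R]_n.+1) : R * 'rV[R]_n :=
  (x ord0 ord0, \row_i x ord0 (lift ord0 i)).

Let rVconsK : cancel rVcons rVuncons.
Proof.
move=> [a v]; rewrite /rVuncons rVcons0; congr pair.
by apply/rowP => i; rewrite mxE rVconsS.
Qed.

Let measurable_rVuncons : measurable_fun setT rVuncons.
Proof.
apply/measurable_fun_pairP; split; first exact: measurable_coord.
apply: measurable_fun_coordP => i.
by under eq_fun do rewrite mxE; exact: measurable_coord.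
Qed.

Let lebesgue_cons_sigma_finite : sigma_finite setT lebesgue_cons.
Proof.
have /sigma_finiteP[F [FT ndF Foo]] := sigma_finiteT (@lebesgue_measure R).
have /sigma_finiteP[G [GT ndG Goo]] := sigma_finiteT mu.
pose H k := F (k : nat) `*` G k.
exists (fun k => rVuncons @^-1` H k).
  rewrite -preimage_bigcup (_ : \bigcup_k H k = setT) ?preimage_setT//.
  apply/seteqP; split => // -[a v] _.
  have [k _ Fa] : (\bigcup_k F k) a by rewrite -FT.
  have [l _ Gv] : (\bigcup_k G k) v by rewrite -GT.
  exists (maxn k l) => //; split => /=.
    by move: a Fa; exact/subsetPset/ndF/leq_maxl.
  by move: v Gv; exact/subsetPset/ndG/leq_maxr.
move=> k; split.
  rewrite -[X in measurable X]setTI; apply: measurable_rVuncons => //.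
  by apply: measurableX; [exact: (Foo k).1|exact: (Goo k).1].
rewrite /lebesgue_cons /pushforward -comp_preimage.
rewrite (_ : rVuncons \o rVcons = id); last exact/funext/rVconsK.
rewrite product_measure1E; [|exact: (Foo k).1|exact: (Goo k).1].
by rewrite lte_mul_pinfty ?ge0_fin_numE ?(Foo k).2 ?(Goo k).2.
Qed.

HB.instance Definition _ := Measure_isSigmaFinite.Build _ _ _ lebesgue_cons
  lebesgue_cons_sigma_finite.

End lebesgue_cons.

Fixpoint lebesgue_rV {R : realType} (n : nat) :
    {sigma_finite_measure set 'rV[R]_n -> \bar R} :=
  match n with
  | 0 => \d_(0 : 'rV[R]_0)
  | m.+1 => lebesgue_cons (lebesgue_rV m)
  end.

Lemma lebesgue_rV_box (R : realType) n (A : 'I_n -> set R) :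
  (forall i, measurable (A i)) ->
  lebesgue_rV n [set x | forall i, A i (x ord0 i)]
    = (\prod_(i < n) lebesgue_measure (A i))%E.
Proof.
elim: n A => [|n ih] A mA.
  by rewrite big_ord0 /= diracE mem_set// => -[].
rewrite big_ord_recl -ih//= /lebesgue_cons /pushforward -product_measure1E//.
- congr (_ _); apply/seteqP; split => -[a v] /=.
  + move=> H; split => /=; first by have := H ord0; rewrite rVcons0.
    by move=> i; have := H (lift ord0 i); rewrite rVconsS.
  + move=> [/= H0 HS] i; case: (unliftP ord0 i) => [j ->|->].
      by rewrite rVconsS; exact: HS.
    by rewrite rVcons0.
- exact: mA.
- rewrite [X in measurable X](_ : _ =
      \bigcap_(i in [set: 'I_n]) ((fun x : 'rV[R]_n => x ord0 i) @^-1` A (lift ord0 i))).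
    apply: fin_bigcap_measurable => // i _.
    by rewrite -[X in measurable X]setTI; exact: measurable_coord.
  by apply/seteqP; split => [x H i _|x H i]; exact: H.
Qed.

(* Functions on Omega are represented by functions on R^n, whose values outside
   Omega are irrelevant and which are identified when equal a.e. on Omega. *)
Section function_spaces.
Context {R : realType} {n : nat} (Omega : set 'rV[R]_n).
Local Notation fct := ('rV[R]_n -> R).
Local Notation leb := (lebesgue_rV n).
Implicit Types (u v : fct) (g h : 'I_n -> fct) (w : fct -> R).

Definition normL (q : R) v : \bar R := 'N[leb]_q%:E[EFin \o v \_ Omega]%E.

Definition L2 v : Prop := v \_ Omega \in Lfun leb 2%:E.

Definition inner v u : R := (\int[leb]_(x in Omega) (v x * u x))%R.

Definition is_zero v : Prop := {ae leb, forall x, Omega x -> v x = 0}.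

Definition partial (i : 'I_n) v : fct := fun x => 'D_(delta_mx 0 i) v x.

Definition smooth v : Prop := forall s : seq 'I_n,
  continuous (foldr partial v s) /\
  forall i x, derivable (foldr partial v s) x (delta_mx 0 i).

Definition test_function v : Prop :=
  let supp := closure [set x | v x != 0] in
  [/\ smooth v, compact supp & supp `<=` Omega].

Definition innerV g h : R := \sum_(i < n) inner (g i) (h i).

Definition normV g : \bar R :=
  normL 2 (fun x => Num.sqrt (\sum_(i < n) g i x ^+ 2)).

(* [H01_grad v g]: v is in H^1_0(Omega), the closure of the test functions in
   H^1(Omega), and g is its weak gradient. *)
Definition H01_grad v g : Prop :=
  [/\ L2 v, forall i, L2 (g i) &
    exists phi : nat -> fct, [/\ forall k, test_function (phi k),
      normL 2 (phi k - v) @[k --> \oo] --> 0%E &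
      normV (fun i => partial i (phi k) - g i) @[k --> \oo] --> 0%E]].

Definition H01 v : Prop := exists g, H01_grad v g.

(* Unique up to a.e. equality on Omega when v is in H^1_0(Omega). *)
Definition grad v : 'I_n -> fct := xget (fun=> 0) [set g | H01_grad v g].

(* H^{-1}(Omega), as functionals on H^1_0(Omega) normed by ||grad v||. *)
Definition Hm1 w : Prop :=
  (forall (a : R) v u, H01 v -> H01 u -> w (a *: v + u) = a * w v + w u) /\
  exists C : R, forall v, H01 v -> (`|w v|%:E <= C%:E * normV (grad v))%E.

Definition normHm1 w : \bar R :=
  ereal_sup [set `|w v|%:E | v in [set v | H01 v /\ (normV (grad v) <= 1)%E]].

(* Eigenpairs of the Dirichlet Laplacian, indexed from 0 (so that lam 0 is
   lambda_1); the eigenvalue equation is in its weak form in H^1_0(Omega). *)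
Definition dirichlet_eigenpairs (lam : nat -> R) (e : nat -> fct) : Prop :=
  [/\ 0 < lam 0%N, {homo lam : j k / (j <= k)%N >-> j <= k},
      forall k, H01 (e k) /\
        forall v, H01 v -> innerV (grad (e k)) (grad v) = lam k * inner (e k) v,
      forall j k, inner (e j) (e k) = (j == k)%:R &
      forall v, L2 v ->
        normL 2 (\sum_(k < m) inner v (e k) *: e k - v) @[m --> \oo] --> 0%E].

Section fractional_powers.
Variables (lam : nat -> R) (e : nat -> fct) (s : R).

Definition domA v : Prop := L2 v /\
  (\sum_(0 <= k <oo) (lam k `^ (2 * s) * inner v (e k) ^+ 2)%:E < +oo)%E.

Definition powA v : fct := xget 0 [set z | L2 z /\
  normL 2 (\sum_(k < m) (lam k `^ s * inner v (e k)) *: e k - z)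
    @[m --> \oo] --> 0%E].

End fractional_powers.

End function_spaces.

Definition time_itv {R : realType} (T : \bar R) : set R :=
  [set t | 0 <= t /\ (t%:E < T)%E].

(* f is in L^2_loc([0,T); X), where X is normed by N: f is strongly measurable,
   i.e. an a.e. limit of simple functions, and N(f)^2 is integrable on compact
   subintervals. *)
Section bochner.
Context {R : realType} {V : lmodType R} (X : set V) (N : V -> \bar R) (T : \bar R).

Definition simple_map (s : R -> V) : Prop :=
  exists m (A : 'I_m -> set R) (c : 'I_m -> V),
    (forall i, measurable (A i) /\ X (c i)) /\
    forall t, s t = \sum_(i < m) \1_(A i) t *: c i.

Definition L2loc (f : R -> V) : Prop :=
  [/\ {ae lebesgue_measure, forall t, time_itv T t -> X (f t)},
      exists s : nat -> R -> V, (forall k, simple_map (s k)) /\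
        {ae lebesgue_measure, forall t, time_itv T t ->
          N (s k t - f t) @[k --> \oo] --> 0%E} &
      forall b : R, time_itv T b ->
        (\int[lebesgue_measure]_(t in `[0%R, b]) N (f t) ^+ 2 < +oo)%E].

End bochner.

Definition time_test_function {R : realType} (T : \bar R) (phi : R -> R) : Prop :=
  let supp := closure [set t | phi t != 0] in
  [/\ forall k t, derivable (derive1n k phi) t 1, compact supp &
      supp `<=` [set t | 0 < t /\ (t%:E < T)%E]].

Section problem.
Context {R : realType} {n : nat} (Omega : set 'rV[R]_n).
Context (lam : nat -> R) (e : nat -> 'rV[R]_n -> R) (theta p : R).
Local Notation fct := ('rV[R]_n -> R).
Local Notation Ahalf := (powA Omega lam e (theta / 2)).
Local Notation domAhalf := (domA Omega lam e (theta / 2)).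
Implicit Types (u ut : R -> fct) (T : \bar R).

Definition Phi (v1 v0 : fct) : \bar R :=
  (normL Omega 2 v1 ^+ 2 + normV Omega (grad Omega v0) ^+ 2)%E.

Definition Energy (v1 v0 : fct) : \bar R :=
  ((2^-1)%:E * normL Omega 2 v1 ^+ 2
    + (2^-1)%:E * normV Omega (grad Omega v0) ^+ 2
    - ((p + 1)^-1)%:E * normL Omega (p + 1) v0 `^ (p + 1))%E.

(* ut is the derivative of u in C([0,T); L^2(Omega)) (one-sided at 0). *)
Definition C1_L2 T u ut : Prop :=
  forall t, time_itv T t ->
    [/\ L2 Omega (u t), L2 Omega (ut t),
      normL Omega 2 ((r - t)^-1 *: (u r - u t) - ut t)
        @[r --> within (time_itv T) t^'] --> 0%E &
      normL Omega 2 (ut r - ut t) @[r --> within (time_itv T) (nbhs t)] --> 0%E].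

Definition C_H01 T u : Prop :=
  forall t, time_itv T t -> H01 Omega (u t) /\
    normV Omega (grad Omega (u r) - grad Omega (u t))
      @[r --> within (time_itv T) (nbhs t)] --> 0%E.

(* utt is the H^{-1}(Omega)-valued distributional derivative of ut on (0,T). *)
Definition weak_time_derivative T ut (utt : R -> fct -> R) : Prop :=
  forall v phi, H01 Omega v -> time_test_function T phi ->
    (\int[lebesgue_measure]_(t in time_itv T) (derive1 phi t * inner Omega (ut t) v)
     = - \int[lebesgue_measure]_(t in time_itv T) (phi t * utt t v))%R.

Definition energy_solution T (u0 u1 : fct) u : Prop :=
  exists ut : R -> fct, exists utt : R -> fct -> R,
  [/\ (0 < T)%E,
    [/\ C_H01 T u, C1_L2 T u ut &
      L2loc domAhalf (fun v => normL Omega 2 (Ahalf v)) T ut],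
    [/\ is_zero Omega (u 0 - u0), is_zero Omega (ut 0 - u1),
      L2loc (Hm1 Omega) (normHm1 Omega) T utt, weak_time_derivative T ut utt &
      {ae lebesgue_measure, forall t, time_itv T t -> forall v, H01 Omega v ->
        utt t v + inner Omega (Ahalf (ut t)) (Ahalf v)
          + innerV Omega (grad Omega (u t)) (grad Omega v)
        = inner Omega (fun x => `|u t x| `^ (p - 1) * u t x) v}],
    (forall t, time_itv T t ->
      Energy (ut t) (u t)
        + \int[lebesgue_measure]_(s in `[0%R, t]) normL Omega 2 (Ahalf (ut s)) ^+ 2
      <= Energy (ut 0%R) (u 0%R))%E &
    (T = +oo \/ (T < +oo)%E /\
      limf_esup (fun t => Phi (ut t) (u t)) (at_left (fine T)) = +oo)%E].

(* q_theta and its conjugate exponent. *)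
Definition qexp : R :=
  if (n <= 2)%N then 2 else 2 * n%:R / (n%:R - 2 * theta).

Definition qexp' : R :=
  if (n <= 2)%N then 2 else 2 * n%:R / (n%:R + 2 * theta).

Definition Sconst : \bar R :=
  ereal_sup [set (normL Omega qexp v / normL Omega 2 (Ahalf v))%E |
    v in [set v | domAhalf v /\ ~ is_zero Omega v]].

Definition Bconst : \bar R :=
  ereal_sup [set (normL Omega (p * qexp') v / normV Omega (grad Omega v))%E |
    v in [set v | H01 Omega v /\ ~ is_zero Omega v]].

Definition Kconst : \bar R :=
  ((2^-1)%:E * Sconst ^+ 2 * Bconst `^ (2 * p))%E.

End problem.

(* Main.v *)
(** Let [F v] be the integral of [|v|^(p+1)] and [a t = |A^(theta/2) u_t(t)|].
    By convexity of [F], Hoelder's inequality with the conjugate exponents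
    [q'] and [q], and the two embeddings,
      [F(u t) - F(u s) <= (p+1) B^p |grad u(t)|^p S |A^(theta/2)(u t - u s)|],
    and [|A^(theta/2)(u t - u s)|^2 <= (t - s) * \int_s^t a^2] coefficientwise in
    the eigenbasis.  No chain rule for [F] is needed.  Hence
      [H t = Phi 0 + 2/(p+1) (F(u t) - F(u 0)) - 2 \int_0^t a^2],
    which dominates [Phi] by the energy inequality, satisfies
      [H t - H s <= (t - s) K (H t)^p]   for [s <= t]
    by Young's inequality.  This discrete form of [H' <= K H^p] gives
    [Phi(0)^(1-p) - (H t)^(1-p) <= (p-1) K t], so [Phi] stays bounded up to
    [Tmax] if [Tmax] is smaller than claimed, which contradicts the blow-up
    alternative.  If [S] or [B] is infinite, the claimed bound is [0]. *)

Require Import Defs.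
From mathcomp Require Import all_boot all_order all_algebra.
From mathcomp Require Import all_classical all_reals all_analysis.
From mathcomp Require Import measurable_realfun ring lra.

Set Implicit Arguments.
Unset Strict Implicit.
Unset Printing Implicit Defensive.

Import Order.TTheory GRing.Theory Num.Theory.
Import numFieldNormedType.Exports HBNNSimple.

Local Open Scope classical_set_scope.
Local Open Scope ring_scope.

(** * Power functions and a discrete Gronwall inequality *)

(** The energy inequality compares time [t] with time [0] only, so it says nothing about increments
    of [Phi] between two positive times. Solved for [Phi] at time [t], its right-hand side is [H t],
    and the increments of [H] contain only those of [F] and of the dissipation integral, both of
    which can be estimated directly. [H] is not known to be differentiable, so the comparison runs
    over finite grids. The tangent in the convexity step is taken at the later time [t], so the
    power of [H] is evaluated at the right end of each step, as in an implicit Euler scheme; making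
    the step explicit costs a factor that tends to [1]. The constant arises as follows: the
    increment of [F] carries the square root of [t - s] times the dissipation on [[s, t]]; Young's
    inequality absorbs that root into the term [-2 \int a^2] of [H] and leaves
    [(t - s) (S B^p |grad u(t)|^p)^2 / 2], that is, [(t - s) K |grad u(t)|^(2p)], where
    [|grad u(t)|^2 <= Phi <= H t]. *)

Lemma powR_tangent (R : realType) (x y p : R) : 0 <= x -> 0 <= y -> 0 < p ->
  x `^ (p + 1) + (p + 1) * x `^ p * (y - x) <= y `^ (p + 1).
Proof.
move=> x0 y0 p0; have p10 : 0 < p + 1 by rewrite addr_gt0.
have p1 : p + 1 != 0 by rewrite gt_eqF.
(* Young's inequality for the product of [x ^ p] and [y] with exponents [(p + 1) / p] and [p + 1];
   the tangent inequality is this one multiplied by [p + 1]. *)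
have := @conjugate_powR R (x `^ p) y ((p + 1) / p) (p + 1) (powR_ge0 _ _) y0.
rewrite divr_gt0// => /(_ isT p10); rewrite invf_div.
have -> : p / (p + 1) + (p + 1)^-1 = 1 by field.
move=> /(_ erefl); rewrite -powRrM.
have -> : p * ((p + 1) / p) = p + 1 by field; rewrite gt_eqF.
have -> : x `^ (p + 1) = x `^ p * x.
  by rewrite powRD ?powRr1//; apply/implyP => /eqP h; move: p1; rewrite h eqxx.
rewrite -(ler_pM2l p10).
have -> z w : (p + 1) * (z * (p / (p + 1)) + w / (p + 1)) = p * z + w.
  by field.
lra.
Qed.

(* Young's inequality with exponents [p] and [p / (p - 1)]. *)
Lemma powRN_tangent (R : realType) (x y p : R) : 0 < x -> 0 < y -> 1 < p ->
  x `^ (1 - p) - y `^ (1 - p) <= (p - 1) * x `^ (- p) * (y - x).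
Proof.
move=> x0 y0 p1; have p0 : 0 < p by lra.
have q0 : 0 < p / (p - 1) by rewrite divr_gt0//; lra.
have xE (z : R) : 0 < z -> z `^ (1 - p) = z `^ (- p) * z.
  by move=> z0; rewrite -{3}(powRr1 (ltW z0)) -powRD ?(gt_eqF z0) ?implybT// addrC.
(* The factors are chosen so that the powers of [y] cancel in their product, which is
   [x ^ (1 - p)]. *)
have := @conjugate_powR R (y `^ ((1 - p) / p))
  (x `^ (1 - p) * y `^ ((p - 1) / p)) p (p / (p - 1)) (powR_ge0 _ _).
rewrite mulr_ge0 ?powR_ge0// => /(_ isT p0 q0).
rewrite invf_div; have -> : p^-1 + (p - 1) / p = 1 by field; lra.
move=> /(_ erefl); rewrite powRM ?powR_ge0// -!powRrM.
have -> : (1 - p) / p * p = 1 - p by field; lra.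
have -> : (1 - p) * (p / (p - 1)) = - p by field; lra.
have -> : (p - 1) / p * (p / (p - 1)) = 1 by field; lra.
rewrite powRr1 ?(ltW y0)// mulrCA -powRD ?(gt_eqF y0) ?implybT//.
have -> : (1 - p) / p + (p - 1) / p = 0 by field; lra.
rewrite powRr0 mulr1 -(ler_pM2l p0) mulrDr.
have -> : p * (y `^ (1 - p) / p) = y `^ (1 - p) by field; lra.
have -> : p * (x `^ (- p) * y * ((p - 1) / p)) = (p - 1) * x `^ (-p) * y.
  by field; lra.
by rewrite (xE _ x0); nra.
Qed.

(** The slope is taken at [a] alone. After integration with [a = u(t)] and [b = u(s)], only the
    gradient at the later time enters the bound. *)
Lemma powR_norm_convex (R : realType) (a b p : R) : 0 < p ->
  `|a| `^ (p + 1) <= `|b| `^ (p + 1) + (p + 1) * (`|a| `^ p * `|a - b|).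
Proof.
move=> p0; have := powR_tangent (normr_ge0 a) (normr_ge0 b) p0.
have : (p + 1) * (`|a| `^ p * (`|a| - `|b|)) <= (p + 1) * (`|a| `^ p * `|a - b|).
  by rewrite ler_pM2l ?ler_wpM2l ?powR_ge0 ?lerB_dist//; lra.
lra.
Qed.

(** The increment is bounded by a power of the new value [y], whereas the tangent of [z ^ (1 - p)]
    at [x] calls for a power of [x]. The crude bounds [y <= M] and [c <= x] give
    [y <= x * (1 + d * L)] with [L = K * M ^ p / c]; thus [c] and [M] enter only through a factor
    that tends to [1] with [d]. *)
Lemma gronwall_power_step (R : realType) (K p c M x y d : R) :
  1 < p -> 0 <= K -> 0 < c -> 0 <= d -> c <= x -> c <= y -> y <= M ->
  y - x <= d * K * y `^ p ->
  x `^ (1 - p) - y `^ (1 - p) <=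
    (p - 1) * K * (d * (1 + d * (K * M `^ p / c)) `^ p).
Proof.
move=> p1 K0 c0 d0 cx cy yM H.
have x0 := lt_le_trans c0 cx; have y0 := lt_le_trans c0 cy.
have p0 : 0 <= p by lra.
apply: (le_trans (powRN_tangent x0 y0 p1)).
set L := K * M `^ p / c.
have L0 : 0 <= L by rewrite divr_ge0 ?mulr_ge0 ?powR_ge0// ltW.
have yL : y <= x * (1 + d * L).
  have : y `^ p <= M `^ p by apply: ge0_ler_powR; rewrite ?nnegrE//; lra.
  move=> /(ler_wpM2l (mulr_ge0 d0 K0)) h.
  have : d * K * M `^ p <= x * (d * L).
    rewrite /L; have -> : x * (d * (K * M `^ p / c)) =
      (x / c) * (d * K * M `^ p) by ring.
    by rewrite ler_peMl ?mulr_ge0 ?powR_ge0// ler_pdivlMr// mul1r.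
  lra.
have dL0 : 0 <= 1 + d * L by rewrite addr_ge0 ?(mulr_ge0 d0 L0).
have : y `^ p <= x `^ p * (1 + d * L) `^ p.
  rewrite -powRM ?(ltW x0)//.
  by apply: ge0_ler_powR; rewrite ?nnegrE ?mulr_ge0 ?(ltW x0) ?(ltW y0).
move=> /(ler_wpM2l (mulr_ge0 d0 K0)) H2.
have xp : 0 < x `^ p by rewrite powR_gt0.
have := le_trans H H2; rewrite powRN => H3.
have pp : 0 < p - 1 by rewrite subr_gt0.
rewrite -mulrA -[leRHS]mulrA (ler_pM2l pp).
by rewrite [leLHS]mulrC ler_pdivrMr//; lra.
Qed.

(* Sum [gronwall_power_step] over [N.+1] equal steps: the error factor
   [(1 + b / N.+1 * L)^p] tends to [1]. *)
Lemma gronwall_power (R : realType) (W : R -> R) (K p c M b : R) :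
  1 < p -> 0 <= K -> 0 < c -> 0 <= b ->
  (forall t : R, 0 <= t <= b -> c <= W t <= M) ->
  (forall s t : R, 0 <= s -> s <= t -> t <= b ->
    W t - W s <= (t - s) * K * W t `^ p) ->
  W 0 `^ (1 - p) - W b `^ (1 - p) <= (p - 1) * K * b.
Proof.
move=> p1 K0 c0 b0 Wbnd Wincr.
set L := K * M `^ p / c.
have L0 : 0 <= L by rewrite divr_ge0 ?mulr_ge0 ?powR_ge0// ltW.
have step (s t : R) : 0 <= s -> s <= t -> t <= b ->
    W s `^ (1 - p) - W t `^ (1 - p) <=
    (p - 1) * K * ((t - s) * (1 + (t - s) * L) `^ p).
  move=> s0 st tb.
  have /andP[cs sM] : c <= W s <= M by apply: Wbnd; rewrite s0 (le_trans st).
  have /andP[ct tM] : c <= W t <= M by apply: Wbnd; rewrite tb (le_trans s0).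
  by apply: gronwall_power_step; rewrite ?subr_ge0//; exact: Wincr.
clearbody L.
have sub N : W 0 `^ (1 - p) - W b `^ (1 - p) <=
    (p - 1) * K * b * (1 + b / N.+1%:R * L) `^ p.
  pose t i : R := i%:R * (b / N.+1%:R).
  have d0 : 0 <= b / N.+1%:R by rewrite divr_ge0.
  have tN : t N.+1 = b by rewrite /t mulrCA divff ?mulr1.
  have tt i : t i.+1 - t i = b / N.+1%:R by rewrite /t -mulrBl -natrB// subSnn mul1r.
  have : forall k, (k <= N.+1)%N -> W 0 `^ (1 - p) - W (t k) `^ (1 - p) <=
      k%:R * ((p - 1) * K * (b / N.+1%:R * (1 + b / N.+1%:R * L) `^ p)).
    elim=> [_|k ih kN]; first by rewrite /t mul0r subrr mul0r.
    have := ih (ltnW kN).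
    have tk0 : 0 <= t k by rewrite mulr_ge0.
    have tkS : t k <= t k.+1 by rewrite -subr_ge0 tt.
    have tb : t k.+1 <= b by rewrite -tN ler_wpM2r ?ler_nat.
    have := step _ _ tk0 tkS tb; rewrite tt -[k.+1%:R]natr1 [(k%:R + 1) * _]mulrDl mul1r => h1 h2.
    by rewrite -(subrKA (W (t k) `^ (1 - p))); exact: lerD.
  move=> /(_ N.+1 (leqnn _)); rewrite tN; congr (_ <= _).
  have : N.+1%:R != 0 :> R by rewrite pnatr_eq0.
  by move: (_ `^ p) => Z; move: N.+1%:R => m m0; field.
(* If the claim fails, the ratio [r] of its two sides exceeds [1], while [sub] bounds its [p]-th
   root by [1 + b / N.+1 * L] for every [N]; a large [N] is then contradictory. The case of a zero
   right-hand side is removed before dividing. *)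
rewrite leNgt; apply/negP => lt.
have A0 : 0 <= (p - 1) * K * b by rewrite !mulr_ge0//; lra.
move: A0; rewrite le_eqVlt => /predU1P[A0|A0].
  by have := sub 0%N; rewrite -A0 mul0r; lra.
pose r := (W 0 `^ (1 - p) - W b `^ (1 - p)) / ((p - 1) * K * b).
have r1 : 1 < r by rewrite /r ltr_pdivlMr// mul1r.
have r0 : 0 < r by lra.
have p0 : 0 < p by lra.
have rp : 1 < r `^ p^-1.
  have : 1 `^ p^-1 < r `^ p^-1.
    by apply: gt0_ltr_powR; rewrite ?invr_gt0 ?nnegrE// ltW.
  by rewrite powR1.
have sub' k : r `^ p^-1 <= 1 + b / k.+1%:R * L.
  have : r <= (1 + b / k.+1%:R * L) `^ p by rewrite /r ler_pdivrMr// mulrC.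
  have x0 : 0 <= 1 + b / k.+1%:R * L by rewrite addr_ge0 ?mulr_ge0 ?divr_ge0.
  move=> h; rewrite -[leRHS]powRr1// -[X in _ <= _ `^ X](divff (lt0r_neq0 p0)) powRrM.
  by apply: ge0_ler_powR; rewrite ?invr_ge0 ?nnegrE ?powR_ge0 ?(ltW p0) ?(ltW r0).
have e0 : 0 < r `^ p^-1 - 1 by lra.
have xr0 : 0 <= b * L / (r `^ p^-1 - 1) by rewrite divr_ge0 ?mulr_ge0 ?(ltW e0).
have := archi_boundP xr0; set k := Num.bound _ => hk.
have := sub' k; rewrite leNgt => /negP; apply.
rewrite -ltrBrDl mulrAC ltr_pdivrMr ?ltr0n// [ltRHS]mulrC -ltr_pdivrMr//.
by rewrite (lt_le_trans hk)// ler_nat.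
Qed.

(** * Semi-inner products *)

(** Functions are not identified when equal almost everywhere, so the forms are not definite; and an
    integral is meaningful only for square-integrable arguments, whence the carrier [S]. The same
    theory serves [ip], [inner] and [innerV]. *)
Record semi_inner (R : realType) (V : lmodType R) (S : set V) (B : V -> V -> R) := {
  semi_inner_lin : forall a x y, S x -> S y -> S (a *: x + y);
  semi_inner0 : S 0;
  semi_innerC : forall x y, S x -> S y -> B x y = B y x;
  semi_innerL : forall a x y z, S x -> S y -> S z ->
    B (a *: x + y) z = a * B x z + B y z;
  semi_inner_ge0 : forall x, S x -> 0 <= B x x }.

Section semi_inner_theory.
Context {R : realType} {V : lmodType R} (S : set V) (B : V -> V -> R).
Hypothesis HB : semi_inner S B.
Implicit Types x y z : V.

Definition semi_norm x := Num.sqrt (B x x).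
Local Notation N := semi_norm.

Lemma siS_add x y : S x -> S y -> S (x + y).
Proof. by move=> Sx Sy; rewrite -[x]scale1r; exact: (semi_inner_lin HB). Qed.

Lemma siS_scale a x : S x -> S (a *: x).
Proof.
by move=> Sx; rewrite -[_ *: _]addr0; apply: (semi_inner_lin HB) => //; exact: (semi_inner0 HB).
Qed.

Lemma siS_opp x : S x -> S (- x).
Proof. by rewrite -scaleN1r; exact: siS_scale. Qed.

Lemma siS_sub x y : S x -> S y -> S (x - y).
Proof. by move=> Sx Sy; apply: siS_add => //; exact: siS_opp. Qed.

Lemma siS_sum (x : nat -> V) m : (forall k, S (x k)) -> S (\sum_(k < m) x k).
Proof.
by move=> Sx; elim/big_ind: _ => //; [exact: (semi_inner0 HB)|exact: siS_add].
Qed.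

Lemma siDl x y z : S x -> S y -> S z -> B (x + y) z = B x z + B y z.
Proof.
by move=> Sx Sy Sz; rewrite -[x]scale1r (semi_innerL HB)// mul1r scale1r.
Qed.

Lemma si0l z : S z -> B 0 z = 0.
Proof.
move=> Sz; have S0 := semi_inner0 HB.
have := siDl S0 S0 Sz; rewrite addr0 => /eqP.
by rewrite -{1}[B 0 z]addr0 (inj_eq (addrI _)) => /eqP.
Qed.

Lemma siZl a x z : S x -> S z -> B (a *: x) z = a * B x z.
Proof.
move=> Sx Sz; have S0 := semi_inner0 HB.
by rewrite -[_ *: _]addr0 (semi_innerL HB)// si0l// addr0.
Qed.

Lemma siNl x z : S x -> S z -> B (- x) z = - B x z.
Proof. by move=> Sx Sz; rewrite -scaleN1r siZl// mulN1r. Qed.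

Lemma siBl x y z : S x -> S y -> S z -> B (x - y) z = B x z - B y z.
Proof. by move=> Sx Sy Sz; rewrite siDl ?siNl//; exact: siS_opp. Qed.

Lemma siZr a x z : S x -> S z -> B z (a *: x) = a * B z x.
Proof.
move=> Sx Sz; rewrite (semi_innerC HB)//; last exact: siS_scale.
by rewrite siZl// (semi_innerC HB).
Qed.

Lemma siBr x y z : S x -> S y -> S z -> B z (x - y) = B z x - B z y.
Proof.
move=> Sx Sy Sz; rewrite (semi_innerC HB)//; last exact: siS_sub.
by rewrite siBl// !(semi_innerC HB Sz).
Qed.

Lemma siDr x y z : S x -> S y -> S z -> B z (x + y) = B z x + B z y.
Proof.
move=> Sx Sy Sz; rewrite (semi_innerC HB)//; last exact: siS_add.
by rewrite siDl// !(semi_innerC HB Sz).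
Qed.

Lemma si_suml (x : nat -> V) m z : (forall k, S (x k)) -> S z ->
  B (\sum_(k < m) x k) z = \sum_(k < m) B (x k) z.
Proof.
move=> Sx Sz; elim: m => [|m ih]; first by rewrite !big_ord0 si0l.
by rewrite !big_ord_recr/= siDl ?ih//; exact: siS_sum.
Qed.

Lemma si_expand x y t : S x -> S y ->
  B (x + t *: y) (x + t *: y) = B x x + 2 * t * B x y + t ^+ 2 * B y y.
Proof.
move=> Sx Sy; have Sty : S (t *: y) by exact: siS_scale.
have Sxy : S (x + t *: y) by exact: siS_add.
rewrite siDl// !siDr// !siZl// !siZr// (semi_innerC HB Sy Sx); ring.
Qed.

(** The square of [x + t *: y] is nonnegative for all [t]. Without definiteness the case [B y y = 0]
    is separate: the expression is then affine in [t], and if [B x y] were nonzero the chosen [t]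
    would make it [-1]. Otherwise [t] is the minimiser. *)
Lemma si_CS_sqr x y : S x -> S y -> B x y ^+ 2 <= B x x * B y y.
Proof.
move=> Sx Sy.
have H t : 0 <= B x x + 2 * t * B x y + t ^+ 2 * B y y.
  rewrite -si_expand//; apply: (semi_inner_ge0 HB); apply: siS_add => //.
  exact: siS_scale.
have := semi_inner_ge0 HB Sy; rewrite le_eqVlt => /predU1P[y0|y0].
  rewrite -y0 mulr0; have [->|b0] := eqVneq (B x y) 0; first by rewrite expr0n.
  have := H (- (B x x + 1) / (2 * B x y)); rewrite -y0 mulr0 addr0.
  have -> : 2 * (- (B x x + 1) / (2 * B x y)) * B x y = - (B x x + 1) by field.
  lra.
have := H (- B x y / B y y).
have -> : B x x + 2 * (- B x y / B y y) * B x y + (- B x y / B y y) ^+ 2 * B y y =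
  (B x x * B y y - B x y ^+ 2) / B y y by field; rewrite gt_eqF.
by rewrite pmulr_lge0 ?invr_gt0// subr_ge0.
Qed.

Lemma semi_norm_ge0 x : 0 <= N x. Proof. exact: sqrtr_ge0. Qed.

Lemma semi_norm_sqr x : S x -> N x ^+ 2 = B x x.
Proof. by move=> Sx; rewrite sqr_sqrtr// (semi_inner_ge0 HB). Qed.

Lemma si_CS x y : S x -> S y -> `|B x y| <= N x * N y.
Proof.
move=> Sx Sy; rewrite -sqrtrM ?(semi_inner_ge0 HB)// -sqrtr_sqr.
by rewrite ler_wsqrtr// si_CS_sqr.
Qed.

Lemma semi_normD x y : S x -> S y -> N (x + y) <= N x + N y.
Proof.
move=> Sx Sy; rewrite -(ler_pXn2r (_ : 0 < 2)%N)// ?nnegrE ?addr_ge0 ?semi_norm_ge0//.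
rewrite sqrrD !semi_norm_sqr//; last exact: siS_add.
rewrite -[y in B (_ + y)]scale1r -[y in B _ (_ + y)]scale1r si_expand//.
have := le_trans (ler_norm _) (si_CS Sx Sy); rewrite mulr1 expr1n mul1r; lra.
Qed.

Lemma semi_normN x : S x -> N (- x) = N x.
Proof.
move=> Sx; rewrite /N siNl ?siS_opp//; last exact: siS_opp.
rewrite (semi_innerC HB)// ?siNl ?opprK//; exact: siS_opp.
Qed.

Lemma semi_normB_dist x y : S x -> S y -> `|N x - N y| <= N (x - y).
Proof.
move=> Sx Sy; have Sxy : S (x - y) by exact: siS_sub.
have Syx : S (y - x) by exact: siS_sub.
rewrite ler_norml; apply/andP; split.
  by have := semi_normD Syx Sx; rewrite subrK -opprB semi_normN//; lra.
by have := semi_normD Sxy Sy; rewrite subrK; lra.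
Qed.

(** The weights [w] admit orthogonal systems that are not normalised: [w = 1] for the eigenfunctions
    in L^2, and [w = lam] for their gradients. *)
Lemma si_sum_expand (e : nat -> V) (c w : nat -> R) m y :
  (forall k, S (e k)) -> (forall j k, B (e j) (e k) = w j * (j == k)%:R) ->
  S y ->
  B (\sum_(k < m) c k *: e k - y) (\sum_(k < m) c k *: e k - y) =
  \sum_(k < m) c k ^+ 2 * w k - 2 * (\sum_(k < m) c k * B (e k) y) + B y y.
Proof.
move=> Se ee Sy.
have Sce k : S (c k *: e k) by exact: siS_scale.
have Ss : S (\sum_(k < m) c k *: e k) by exact: (siS_sum m Sce).
have Ssy : S (\sum_(k < m) c k *: e k - y) by exact: siS_sub.
have sy : B (\sum_(k < m) c k *: e k) y = \sum_(k < m) c k * B (e k) y.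
  by rewrite (si_suml m Sce)//; apply: eq_bigr => k _; rewrite siZl.
rewrite siBl// !siBr// (semi_innerC HB Sy Ss) sy.
suff -> : B (\sum_(k < m) c k *: e k) (\sum_(k < m) c k *: e k) =
  \sum_(k < m) c k ^+ 2 * w k by ring.
rewrite (si_suml m Sce)//; apply: eq_bigr => j _.
rewrite siZl// (semi_innerC HB)// (si_suml m Sce)// (bigD1 j)//= big1 ?addr0.
  by rewrite siZl// ee eqxx mulr1 mulrA.
by move=> k kj; rewrite siZl// ee (inj_eq val_inj) (negPf kj) !mulr0.
Qed.

(** [c k] is the Fourier coefficient [B (e k) y / w k], written without division; the inequality is
    the nonnegativity of the squared distance from [y] to its partial sum. *)
Lemma si_bessel (e : nat -> V) (c w : nat -> R) m y :
  (forall k, S (e k)) -> (forall j k, B (e j) (e k) = w j * (j == k)%:R) ->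
  S y -> (forall k, B (e k) y = w k * c k) ->
  \sum_(k < m) c k ^+ 2 * w k <= B y y.
Proof.
move=> Se ee Sy ey.
have := @si_sum_expand e c w m y Se ee Sy.
have Sce k : S (c k *: e k) by exact: siS_scale.
have Ssy : S (\sum_(k < m) c k *: e k - y).
  by apply: siS_sub => //; exact: (siS_sum m Sce).
have := semi_inner_ge0 HB Ssy => /[swap] ->.
have -> : \sum_(k < m) c k * B (e k) y = \sum_(k < m) c k ^+ 2 * w k.
  by apply: eq_bigr => k _; rewrite ey; ring.
lra.
Qed.

Lemma cvg_semi_norm (T : Type) (F : set_system T) {FF : Filter F} (x : T -> V) y :
  (\forall t \near F, S (x t)) -> S y ->
  N (x t - y) @[t --> F] --> 0 -> N (x t) @[t --> F] --> N y.
Proof.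
move=> Sx Sy h; apply/cvgrPdist_le => e e0.
move/cvgrPdist_le : h => /(_ _ e0); move: Sx; apply: filterS2 => t Sxt.
rewrite sub0r normrN ger0_norm ?semi_norm_ge0// distrC.
by apply: le_trans; exact: semi_normB_dist.
Qed.

Lemma cvg_semi_inner (T : Type) (F : set_system T) {FF : Filter F} (x : T -> V) y z :
  (\forall t \near F, S (x t)) -> S y -> S z ->
  N (x t - y) @[t --> F] --> 0 -> B (x t) z @[t --> F] --> B y z.
Proof.
move=> Sx Sy Sz h; apply/cvgrPdist_le => e e0.
have Nz : 0 < N z + 1 by rewrite ltr_wpDl// semi_norm_ge0.
move/cvgrPdist_le : h => /(_ (e / (N z + 1))); rewrite divr_gt0// => /(_ isT).
move: Sx; apply: filterS2 => t Sxt.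
rewrite sub0r normrN ger0_norm ?semi_norm_ge0// => h.
rewrite distrC -siBl//; apply: (le_trans (si_CS (siS_sub Sxt Sy) Sz)).
apply: le_trans (_ : N (x t - y) * (N z + 1) <= e); last by rewrite -ler_pdivlMr.
by rewrite ler_wpM2l ?semi_norm_ge0// lerDl.
Qed.

End semi_inner_theory.

(** * Completeness of L^2 *)

Section l2.
Context d (T : measurableType d) (R : realType) (mu : {measure set T -> \bar R}).
Implicit Types f g : T -> R.

Definition l2set : set (T -> R) := [set f | f \in Lfun mu 2%:E].
Definition ip f g : R := (\int[mu]_x (f x * g x))%R.

Lemma l2_measurable f : l2set f -> measurable_fun setT f.
Proof. by rewrite /l2set/= inE => /andP[]; rewrite inE. Qed.

Lemma Lnorm2_sqr f : ('N[mu]_2%:E[EFin \o f] ^+ 2 = \int[mu]_x (f x ^+ 2)%:E)%E.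
Proof.
have : ('N[mu]_2%:E[EFin \o f] `^ 2 = \int[mu]_x (f x ^+ 2)%:E)%E.
  rewrite powR_Lnorm//; apply: eq_integral => x _ /=.
  by rewrite -(poweR_EFin) /= powR_mulrn// real_normK ?num_real.
have := Lnorm_ge0 mu 2%:E (EFin \o f); case: ('N[mu]_2%:E[EFin \o f])%E => [r| |] //.
  by rewrite lee_fin => r0 <-; rewrite poweR_EFin powR_mulrn.
by move=> _ <-; rewrite expe2 mulyy poweRyr ?pnatr_eq0.
Qed.

Lemma l2P f : measurable_fun setT f -> (\int[mu]_x (f x ^+ 2)%:E < +oo)%E -> l2set f.
Proof.
move=> mf fo; rewrite /l2set/= inE; apply/andP; split; first by rewrite inE.
rewrite inE/= /finite_norm ltey; apply/eqP => h.
by move: fo; rewrite -Lnorm2_sqr h ?expe2 mulyy ltxx.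
Qed.

Lemma l2_mul_integrable f g : l2set f -> l2set g ->
  mu.-integrable setT (EFin \o (fun x => f x * g x)).
Proof. by move=> lf lg; apply/Lfun1_integrable/Lfun2_mul_Lfun1. Qed.

Lemma ipE f : l2set f -> ((ip f f)%:E = \int[mu]_x (f x ^+ 2)%:E)%E.
Proof.
move=> lf; rewrite /ip /Rintegral fineK//; last first.
  by apply: integrable_fin_num => //; exact: l2_mul_integrable.
Qed.

Lemma l2_semi_inner : semi_inner l2set ip.
Proof.
have [L0 LL] := @Lfun_submod_closed _ T R mu 2%:E (lee1n 2).
split => //.
- by move=> x y _ _; apply: eq_Rintegral => z _; rewrite mulrC.
- move=> a x y z Lx Ly Lz.
  have Laxz : mu.-integrable setT (EFin \o (fun t => a * (x t * z t))).
    by apply: (@integrableZl _ _ _ mu setT _ a (EFin \o (fun t => x t * z t))) => //;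
      exact: l2_mul_integrable.
  rewrite /ip -RintegralZl//; last exact: l2_mul_integrable.
  rewrite -RintegralD//; last exact: l2_mul_integrable.
  by apply: eq_Rintegral => t _; rewrite mulrDl -mulrA.
- by move=> x _; apply: Rintegral_ge0 => t _; rewrite -expr2 sqr_ge0.
Qed.

Lemma Lnorm2E f : l2set f -> ('N[mu]_2%:E[EFin \o f] = (semi_norm ip f)%:E)%E.
Proof.
move=> lf; have := Lnorm2_sqr f; rewrite -ipE//.
have := Lnorm_ge0 mu 2%:E (EFin \o f); case: ('N[mu]_2%:E[EFin \o f])%E => [r| |]//=.
  by rewrite lee_fin => r0 [rE]; rewrite /semi_norm -rE sqrtr_sqr ger0_norm.
Qed.

End l2.

Lemma limn_einf_le (R : realType) (u : (\bar R)^nat) (l : \bar R) N :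
  (forall k, (N <= k)%N -> (u k <= l)%E) -> (limn_einf u <= l)%E.
Proof.
move=> ul; rewrite limn_einf_lim; apply: lime_le; first exact: is_cvg_einfs.
near=> n; apply: (@le_trans _ _ (u (maxn n N))); last by apply: ul; rewrite leq_maxr.
by apply: ereal_inf_lbound; exists (maxn n N) => //=; rewrite leq_maxl.
Unshelve. all: by end_near. Qed.

(* By AM-GM, [2 |x| <= 2^k x^2 + 2^-k] for [x = a k.+1 - a k]. *)
Lemma fast_cauchy_cvg (R : realType) (a : nat -> R) (c : R) :
  (forall m, \sum_(k < m) 2 ^+ k * (a k.+1 - a k) ^+ 2 <= c) -> cvgn a.
Proof.
move=> ac.
have -> : a = (fun n => a 0%N + series (telescope a) n).
  by apply/funext => n; exact: eq_sum_telescope.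
apply: is_cvgD; first exact: is_cvg_cst.
apply: normed_cvg.
have -> : [normed series (telescope a)] = (fun n => \sum_(k < n) `|telescope a k|).
  by apply/funext => n; rewrite /normed_series_of/= seriesEord.
apply: nondecreasing_is_cvgn.
  by apply/nondecreasing_seqP => n; rewrite big_ord_recr/= lerDl.
exists ((c + 2) / 2) => _ [n _ <-].
have geo m : \sum_(k < m) (2^-1 : R) ^+ k = 2 - 2 * 2^-1 ^+ m.
  elim: m => [|m ih]; first by rewrite big_ord0 expr0 mulr1 subrr.
  by rewrite big_ord_recr/= ih exprS; field.
apply: (@le_trans _ _ (\sum_(k < n) (2 ^+ k * (a k.+1 - a k) ^+ 2 + 2^-1 ^+ k) / 2)).
  apply: ler_sum => k _; rewrite /telescope; set x := a k.+1 - a k.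
  have -> : `|x| = `|x| * (2 ^+ k * 2^-1 ^+ k) by rewrite -exprMn divff// expr1n mulr1.
  have := real_normK (num_real x); set y := `|x| => <-.
  have : 0 <= 2^-1 ^+ k :> R by rewrite exprn_ge0.
  have : 0 <= 2 ^+ k :> R by rewrite exprn_ge0.
  have : 2 ^+ k * 2^-1 ^+ k = 1 :> R by rewrite -exprMn divff// expr1n.
  move: (2 ^+ k) (2^-1 ^+ k) => s t st s0 t0; rewrite st mulr1 ler_pdivlMr//.
  have : 0 <= s * (y - t) ^+ 2 by rewrite mulr_ge0 ?sqr_ge0.
  have -> : s * (y - t) ^+ 2 = s * y ^+ 2 - 2 * y * (s * t) + t * (s * t) by ring.
  rewrite st; lra.
rewrite -mulr_suml ler_pM2r ?invr_gt0// big_split/= lerD ?ac// geo lerBlDr lerDl.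
by rewrite mulr_ge0// exprn_ge0.
Qed.
Section l2_complete.
Context d (T : measurableType d) (R : realType) (mu : {measure set T -> \bar R}).
Local Notation L := (l2set mu).
Local Notation H := (l2_semi_inner mu).
Variables (f : nat -> T -> R) (fL : forall m, L (f m)).
Hypothesis f_cauchy : forall e : R, 0 < e -> exists N, forall m k,
  (N <= m)%N -> (N <= k)%N -> ip mu (f m - f k) (f m - f k) <= e.

Let fB m k : L (f m - f k). Proof. exact: (siS_sub H). Qed.

(** The rate [4^-k] leaves room for the weights [2^k] of [fast_cauchy_cvg]: the weighted squares
    then have integrals at most [2^-k]. Summing the thresholds [N i] makes [phi] monotone, and
    adding [k] makes it tend to infinity. *)
Lemma fast_subseq : exists phi : nat -> nat,
  (forall N, exists k0, forall k, (k0 <= k)%N -> (N <= phi k)%N) /\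
  forall k, ip mu (f (phi k.+1) - f (phi k)) (f (phi k.+1) - f (phi k)) <= 4^-1 ^+ k.
Proof.
have /choice[N HN] : forall k : nat, exists N, forall m j,
    (N <= m)%N -> (N <= j)%N -> ip mu (f m - f j) (f m - f j) <= 4^-1 ^+ k.
  by move=> k; apply: f_cauchy; rewrite exprn_gt0.
pose phi k := (\sum_(i < k.+1) N i + k)%N.
have Nphi k : (N k <= phi k)%N by rewrite /phi big_ord_recr/= -addnA addnCA leq_addr.
have phiS k : (phi k <= phi k.+1)%N.
  by rewrite /phi [in leqRHS]big_ord_recr/= leq_add ?leq_addr.
exists phi; split => [M|k]; last by apply: HN => //; exact: leq_trans (phiS k).
by exists M => k Mk; rewrite (leq_trans Mk)// leq_addl.
Qed.

(* The last clause makes the limit vanish outside [Omega], which is then not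
   required to be measurable. *)
Lemma l2_complete : exists g, [/\ L g,
  semi_norm (ip mu) (f m - g) @[m --> \oo] --> 0 &
  forall x, (forall m, f m x = 0) -> g x = 0].
Proof.
have [phi [phioo phid]] := fast_subseq.
pose D k x := f (phi k.+1) x - f (phi k) x.
(* [h] has finite integral, so it is finite almost everywhere, and wherever it is finite
   [fast_cauchy_cvg] gives pointwise convergence of the subsequence. *)
pose h x := (\sum_(0 <= k <oo) (2 ^+ k * D k x ^+ 2)%:E)%E.
have mf m : measurable_fun setT (f m) by exact: l2_measurable (fL m).
have mD k : measurable_fun setT (D k) by exact: measurable_funB.
have mD2 k : measurable_fun setT (fun x => (2 ^+ k * D k x ^+ 2)%:E).
  by apply/measurable_EFinP; apply: measurable_funM => //; exact: measurable_funX.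
have D20 k x : (0 <= (2 ^+ k * D k x ^+ 2)%:E)%E.
  by rewrite lee_fin mulr_ge0 ?sqr_ge0// exprn_ge0.
have hoo : (\int[mu]_x h x < +oo)%E.
  rewrite integral_nneseries//.
  apply: (@le_lt_trans _ _ (\sum_(0 <= k <oo) (2^-1 ^+ k : R)%:E)%E).
    apply: lee_nneseries => [k _ _|k _]; first by apply: integral_ge0.
    under eq_integral do rewrite EFinM.
    rewrite ge0_integralZl_EFin ?exprn_ge0//; last 2 first.
    - by move=> x _; rewrite lee_fin sqr_ge0.
    - by apply/measurable_EFinP; exact: measurable_funX.
    rewrite -(ipE (fB (phi k.+1) (phi k))) -EFinM lee_fin.
    have -> : 2^-1 ^+ k = 2 ^+ k * 4^-1 ^+ k :> R.
      by rewrite -exprMn; congr (_ ^+ _); field.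
    by rewrite ler_wpM2l ?exprn_ge0.
  have h2 : (series (geometric (1 : R) 2^-1) n)%:E @[n --> \oo] --> (1 / (1 - 2^-1) : R)%:E.
    apply: cvg_EFin; first by exact: nearW.
    by apply: cvg_geometric_series; rewrite ger0_norm ?invr_ge0// invf_lt1// ltr1n.
  suff -> : (\sum_(0 <= k <oo) (2^-1 ^+ k : R)%:E)%E = (1 / (1 - 2^-1) : R)%:E.
    by rewrite ltry.
  apply/cvg_lim => //; apply: cvg_trans h2; apply: near_eq_cvg.
  by apply: nearW => n; rewrite sumEFin; congr EFin; apply: eq_bigr => i _; rewrite /= mul1r.
have mh : measurable_fun setT h.
  by apply: ge0_emeasurable_sum => //.
have h_fin : {ae mu, forall x, h x \is a fin_num}.
  have hint : mu.-integrable setT h.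
    apply/integrableP; split => //; apply: le_lt_trans hoo.
    by under eq_integral do rewrite gee0_abs ?nneseries_ge0//.
  by have := integrable_ae measurableT hint; apply: filterS => x; exact.
(* The upper limit is measurable on the whole space and equals the limit wherever the subsequence
   converges; [fine] replaces infinite values by [0]. *)
pose g x := fine (limn_esup (fun k => (f (phi k) x)%:E)).
have mg : measurable_fun setT g.
  apply: measurableT_comp => //; apply: measurable_fun_limn_esup => k.
  exact/measurable_EFinP.
have fg : {ae mu, forall x, f (phi k) x @[k --> \oo] --> g x}.
  move: h_fin; apply: filterS => x hx.
  have cv : cvgn (fun k => f (phi k) x).
    apply: (@fast_cauchy_cvg _ _ (fine (h x))) => m.
    rewrite -lee_fin fineK// -sumEFin -(big_mkord xpredT (fun k => (2 ^+ k * D k x ^+ 2)%:E)).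
    exact: nneseries_lim_ge.
  rewrite /g; have -> : limn_esup (fun k => (f (phi k) x)%:E) = (limn (fun k => f (phi k) x))%:E.
    by apply: (cvg_limn_einf_sup _).2; apply: cvg_EFin => //; exact: nearW.
  exact: cv.
(* Fatou's lemma along the subsequence carries the Cauchy estimate over to the limit. It yields both
   that [g] lies in L^2, as [f m - (f m - g)], and that the whole sequence converges to it. *)
have fatou_bnd m e : (forall k, (m <= k)%N -> ip mu (f m - f k) (f m - f k) <= e) ->
    (\int[mu]_x (((f m - g) x) ^+ 2)%:E <= e%:E)%E.
  move=> fe.
  have mfk k : measurable_fun setT (fun x => ((f m - f (phi k)) x ^+ 2)%:E).
    by apply/measurable_EFinP; apply: measurable_funX; exact: measurable_funB.
  apply: (@le_trans _ _ (\int[mu]_x limn_einf (fun k => ((f m - f (phi k)) x ^+ 2)%:E))%E).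
    apply: ae_ge0_le_integral => //.
    - by move=> x _; rewrite lee_fin sqr_ge0.
    - by apply/measurable_EFinP; apply: measurable_funX; exact: measurable_funB.
    - move=> x _; rewrite limn_einf_lim; apply: lime_ge; first exact: is_cvg_einfs.
      by apply: nearW => k; apply: le_ereal_inf_tmp => _ [j _ <-]; rewrite lee_fin sqr_ge0.
    - pose v x k := (- ((f m - f (phi k)) x ^+ 2)%:E)%E.
      rewrite (_ : (fun x => _) = (fun x => - limn_esup (v x))%E); last first.
        apply/funext => x; rewrite -limn_einfN; congr limn_einf.
        by apply/funext => k; rewrite /comp /v oppeK.
      apply: measurableT_comp => //; apply: measurable_fun_limn_esup => k.
      exact: measurableT_comp.
    - move: fg; apply: filterS => x fgx _.
      suff -> : limn_einf (fun k => ((f m - f (phi k)) x ^+ 2)%:E) = ((f m - g) x ^+ 2)%:E by [].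
      apply: (cvg_limn_einf_sup _).1; apply: cvg_EFin; first exact: nearW.
      by apply: cvgM; (apply: cvgB; [exact: cvg_cst|exact: fgx]).
  apply: le_trans (fatou mu measurableT mfk _) _; first by move=> k x _; rewrite lee_fin sqr_ge0.
  have [k0 hk0] := phioo m.
  apply: (@limn_einf_le _ _ _ k0) => k k0k; rewrite -(ipE (fB _ _)) lee_fin.
  by apply: fe; exact: hk0.
have fgL : exists m, L (f m - g).
  have [N hN] := f_cauchy ltr01; exists N.
  apply: l2P; first exact: measurable_funB.
  by apply: le_lt_trans (fatou_bnd N 1 _) (ltry _) => k Nk; exact: hN.
have Lg : L g.
  have [m fgm] := fgL.
  by rewrite -[g](subKr (f m)); exact: (siS_sub H).
exists g; split => //; last first.
  move=> x fx; rewrite /g; under eq_fun do rewrite fx.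
  by rewrite (cvg_limn_einf_sup (cvg_cst _)).2.
apply/cvgrPdist_le => e e0.
have [N hN] := f_cauchy (exprn_gt0 2 e0).
exists N => // m /= Nm; rewrite sub0r normrN ger0_norm ?semi_norm_ge0//.
rewrite -(ler_pXn2r (_ : 0 < 2)%N)// ?nnegrE ?semi_norm_ge0 ?(ltW e0)//.
have Lfg : L (f m - g) by exact: (siS_sub H).
rewrite (semi_norm_sqr H)// -lee_fin ipE//; apply: fatou_bnd => k mk.
by apply: hN => //; exact: leq_trans mk.
Qed.

End l2_complete.

(** * The spaces L^2(Omega) and H^1_0(Omega) *)

Lemma cvg_EFinP (R : realType) (T : Type) (F : set_system T) (FF : Filter F)
    (f : T -> R) (a : R) :
  (f t)%:E @[t --> F] --> a%:E <-> f t @[t --> F] --> a.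
Proof.
split=> [/fine_cvg //|h].
by apply: cvg_EFin => //; exact: nearW.
Qed.

(* Neither function has to be measurable: the null set is cut off from the simple
   functions below [f]. *)
Lemma ae_le_integral d (T : measurableType d) (R : realType)
    (mu : {measure set T -> \bar R}) (D : set T) (f g : T -> \bar R) :
  (forall x, D x -> 0 <= f x)%E -> (forall x, D x -> 0 <= g x)%E ->
  {ae mu, forall x, D x -> (f x <= g x)%E} ->
  (\int[mu]_(x in D) f x <= \int[mu]_(x in D) g x)%E.
Proof.
move=> f0 g0 [N [mN N0 subN]]; rewrite !ge0_integralE//.
apply: ge_ereal_sup => _ /= [h hf <-].
have mNC : measurable (~` N) by exact: measurableC.
pose h' := mul_nnsfun h (indic_nnsfun R mNC).
apply: (@le_trans _ _ (sintegral mu h')).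
  have sE (k : {nnsfun T >-> R}) : sintegral mu k = (\int[mu]_x (k x)%:E)%E.
    by rewrite integral_nnsfun// patch_setT.
  rewrite !sE.
  rewrite le_eqVlt; apply/orP; left; apply/eqP; apply: ge0_ae_eq_integral => //.
  - by apply/measurable_EFinP.
  - by apply/measurable_EFinP.
  - by move=> x _; rewrite lee_fin.
  - by move=> x _; rewrite lee_fin.
  exists N; split => // x /=; apply: contra_notP => Nx _.
  by rewrite /= mindicE mem_set// mulr1.
apply: ereal_sup_ubound; exists h' => //= x; rewrite /= mindicE.
have [Nx|Nx] := pselect (N x).
  by rewrite memNset ?mulr0; [exact: erestrict_ge0|exact].
rewrite mem_set// mulr1; apply: (le_trans (hf x)); rewrite !patchE.
case: ifPn => // /set_mem Dx; apply: contrapT => fg; apply: Nx; apply: subN => /=.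
by move=> /(_ Dx).
Qed.

Section omega.
Context {R : realType} {n : nat} (Omega : set 'rV[R]_n).
Local Notation fct := ('rV[R]_n -> R).
Local Notation mu := (@lebesgue_rV R n).
Local Notation L2 := (L2 Omega).
Local Notation inner := (inner Omega).
Local Notation innerV := (innerV Omega).
Local Notation H01 := (H01 Omega).
Local Notation grad := (grad Omega).
Local Notation normL := (normL Omega).
Local Notation normV := (normV Omega).
Implicit Types (u v : fct) (g h : 'I_n -> fct).

Lemma patch_lin a v u : (a *: v + u) \_ Omega = a *: (v \_ Omega) + u \_ Omega.
Proof.
apply/funext => x; rewrite /patch [RHS]/= !fctE.
by case: ifPn => // _; rewrite scaler0 addr0.
Qed.

Lemma innerE v u : inner v u = ip mu (v \_ Omega) (u \_ Omega).
Proof.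
rewrite /Defs.inner Rintegral_mkcond; apply: eq_Rintegral => x _.
by rewrite /patch; case: ifPn => //; rewrite mulr0.
Qed.

Lemma L2_semi_inner : semi_inner [set v | L2 v] inner.
Proof.
have HB := l2_semi_inner mu; split.
- move=> a x y Lx Ly /=; rewrite /Defs.L2 patch_lin.
  exact: (semi_inner_lin HB a Lx Ly).
- have -> : (0 : fct) = 0 *: 0 + 0 by rewrite scaler0 addr0.
  rewrite /= /Defs.L2 patch_lin scale0r add0r.
  rewrite (_ : _ \_ _ = 0); first exact: (semi_inner0 HB).
  by apply/funext => x; rewrite /patch; case: ifP.
- by move=> x y Lx Ly; rewrite !innerE (semi_innerC HB).
- by move=> a x y z Lx Ly Lz; rewrite !innerE patch_lin (semi_innerL HB).
- by move=> x Lx; rewrite innerE (semi_inner_ge0 HB).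
Qed.

Lemma normL2_sqr v : (normL 2 v ^+ 2 = \int[mu]_x ((v \_ Omega) x ^+ 2)%:E)%E.
Proof. exact: Lnorm2_sqr. Qed.

Lemma normL2E v : L2 v -> normL 2 v = (semi_norm inner v)%:E.
Proof. by move=> Lv; rewrite /semi_norm innerE; exact: Lnorm2E. Qed.

Lemma inner_sqrE v : L2 v ->
  ((inner v v)%:E = \int[mu]_x ((v \_ Omega) x ^+ 2)%:E)%E.
Proof. by move=> Lv; rewrite innerE ipE. Qed.

Lemma innerV_semi_inner : semi_inner [set g | forall i, L2 (g i)] innerV.
Proof.
have HB := L2_semi_inner; split.
- by move=> a x y Lx Ly i; exact: (semi_inner_lin HB a (Lx i) (Ly i)).
- by move=> i; exact: (semi_inner0 HB).
- by move=> x y Lx Ly; rewrite /Defs.innerV; apply: eq_bigr => i _; exact: (semi_innerC HB (Lx i) (Ly i)).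
- move=> a x y z Lx Ly Lz; rewrite /Defs.innerV mulr_sumr -big_split.
  by apply: eq_bigr => i _; exact: (semi_innerL HB a (Lx i) (Ly i) (Lz i)).
- by move=> x Lx; rewrite /Defs.innerV; apply: sumr_ge0 => i _; rewrite (semi_inner_ge0 HB)//; exact: Lx.
Qed.

Lemma normVE g : (forall i, L2 (g i)) -> normV g = (semi_norm innerV g)%:E.
Proof.
move=> Lg; have : (normV g ^+ 2 = (innerV g g)%:E)%E.
  rewrite /Defs.normV normL2_sqr.
  transitivity (\int[mu]_x (\sum_(i < n) ((g i \_ Omega) x ^+ 2)%:E))%E.
    apply: eq_integral => x _; rewrite sumEFin; congr EFin; rewrite /patch.
    case: ifPn => _; last by rewrite big1 ?expr0n.
    by rewrite sqr_sqrtr// sumr_ge0// => i _; rewrite sqr_ge0.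
  rewrite ge0_integral_sum//; last 2 first.
  - move=> i; apply/measurable_EFinP; apply: measurable_funX.
    exact: (l2_measurable (Lg i)).
  - by move=> i x _; rewrite lee_fin sqr_ge0.
  by rewrite /Defs.innerV -sumEFin; apply: eq_bigr => i _; rewrite inner_sqrE.
rewrite /semi_norm /Defs.normV.
have : (0 <= normL 2 (fun x => Num.sqrt (\sum_(i < n) g i x ^+ 2)))%E.
  exact: Lnorm_ge0.
case: (normL 2 _) => [r| |] //.
  by rewrite lee_fin => r0 [<-]; rewrite sqrtr_sqr ger0_norm.
Qed.

Lemma is_zeroP v : L2 v -> is_zero Omega v <-> inner v v = 0.
Proof.
move=> Lv.
have mv2 : measurable_fun setT (fun x => ((v \_ Omega) x ^+ 2)%:E).
  by apply/measurable_EFinP; apply: measurable_funX; exact: (l2_measurable Lv).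
have := ae_eq_integral_abs mu measurableT mv2.
have -> : (\int[mu]_x `|((v \_ Omega) x ^+ 2)%:E| = (inner v v)%:E)%E.
  by rewrite inner_sqrE//; apply: eq_integral => x _; rewrite gee0_abs// lee_fin sqr_ge0.
move=> H; split => [v0|v0].
  suff : ((inner v v)%:E = 0)%E by move=> [].
  apply/H; apply: filterS v0 => x /= + _; rewrite /patch.
  by case: ifPn => [/set_mem Ox ->//|_ _]; rewrite expr0n.
have {H}/H : ((inner v v)%:E = 0)%E by rewrite v0.
apply: filterS => x /(_ I) /= + Ox.
by rewrite patchE mem_set// => -[] /eqP; rewrite sqrf_eq0 => /eqP.
Qed.

Lemma H01_grad_grad v : H01 v -> H01_grad Omega v (grad v).
Proof. by move=> [g Hg]; rewrite /Defs.grad; apply: xgetPex; exists g. Qed.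

Lemma H01_L2 v : H01 v -> L2 v.
Proof. by move=> [g []]. Qed.

Lemma grad_L2 v : H01 v -> forall i, L2 (grad v i).
Proof. by move=> /H01_grad_grad[]. Qed.

Lemma eq_normL2_ae v u : is_zero Omega (v - u) -> normL 2 v = normL 2 u.
Proof.
have le v' u' : is_zero Omega (v' - u') -> (normL 2 v' <= normL 2 u')%E.
  move=> z; rewrite /Defs.normL unlock gt0_ler_poweR ?invr_ge0//.
  - by rewrite in_itv/= leey andbT integral_ge0.
  - by rewrite in_itv/= leey andbT integral_ge0.
  - apply: ae_le_integral => [x _|x _|]; [exact: poweR_ge0..|].
    apply: filterS z => x /= vu _; rewrite /patch; case: ifPn => // /set_mem Ox.
    by have /eqP := vu Ox; rewrite subr_eq0 => /eqP ->.
move=> z; apply/eqP; rewrite eq_le !le//.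
by apply: filterS z => x /= vu Ox; apply: oppr_inj; rewrite oppr0 -(vu Ox) opprB.
Qed.

(** A solution attains its initial data only almost everywhere, so gradients must not see null sets.
    The same approximating test functions serve for both functions. *)
Lemma H01_grad_ae v u g : L2 u -> is_zero Omega (v - u) ->
  H01_grad Omega v g -> H01_grad Omega u g.
Proof.
move=> Lu z [Lv Lg [phi [tphi phiv phig]]]; split => //; exists phi; split => //.
suff -> : (fun k => normL 2 (phi k - u)) = (fun k => normL 2 (phi k - v)) by [].
apply/funext => k; apply: eq_normL2_ae; apply: filterS z => x /= + Ox => /(_ Ox) vu.
by rewrite -vu !fctE opprB addrC subrKA.
Qed.

(* Both gradients are chosen in the same set, so that uniqueness of the weak
   gradient is not needed. *)
Lemma grad_ae v u : L2 v -> L2 u -> is_zero Omega (v - u) -> grad v = grad u.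
Proof.
move=> Lv Lu z; rewrite /Defs.grad; congr xget; apply/seteqP; split => g /=.
  exact: H01_grad_ae.
apply: H01_grad_ae => //; apply: filterS z => x /= vu Ox.
by apply: oppr_inj; rewrite oppr0 -(vu Ox) opprB.
Qed.

End omega.

(** * Dirichlet eigenfunctions and fractional powers *)

Lemma cvg_nneseries (R : realType) (c : nat -> R) (l : R) :
  (forall k, 0 <= c k) -> \sum_(k < m) c k @[m --> \oo] --> l ->
  (\sum_(0 <= k <oo) (c k)%:E = l%:E)%E.
Proof.
move=> c0 /cvg_EFinP h; apply/cvg_lim => //; apply: cvg_trans h.
by apply: near_eq_cvg; apply: nearW => m; rewrite big_mkord sumEFin.
Qed.

Section dirichlet.
Context {R : realType} {n : nat} (Omega : set 'rV[R]_n).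
Local Notation fct := ('rV[R]_n -> R).
Local Notation mu := (@lebesgue_rV R n).
Local Notation L2 := (L2 Omega).
Local Notation inner := (inner Omega).
Local Notation innerV := (innerV Omega).
Local Notation H01 := (H01 Omega).
Local Notation grad := (grad Omega).
Local Notation normL := (normL Omega).
Local Notation N := (semi_norm inner).
Implicit Types (u v z : fct) (g h : 'I_n -> fct).
Variables (lam : nat -> R) (e : nat -> fct).
Hypothesis DE : dirichlet_eigenpairs Omega lam e.

Let HB := L2_semi_inner Omega.

Lemma lam_gt0 k : 0 < lam k.
Proof. by case: DE => l0 lm _ _ _; apply: (lt_le_trans l0); exact: lm. Qed.

Lemma e_H01 k : H01 (e k).
Proof. by case: DE => _ _ /(_ k)[]. Qed.

Lemma eigen_weak k v : H01 v ->
  innerV (grad (e k)) (grad v) = lam k * inner (e k) v.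
Proof. by case: DE => _ _ /(_ k)[_ h] _ _; exact: h. Qed.

Lemma e_L2 k : L2 (e k).
Proof. exact: H01_L2 (e_H01 k). Qed.

(** The factor [1] is the constant weight [w] expected by [si_sum_expand]. *)
Lemma e_orth j k : inner (e j) (e k) = 1 * (j == k)%:R.
Proof. by case: DE => _ _ _ /(_ j k) -> _; rewrite mul1r. Qed.

Lemma partial_sum_L2 (c : nat -> R) m : L2 (\sum_(k < m) c k *: e k).
Proof.
apply: (siS_sum HB (x := fun k => c k *: e k)) => k.
exact: (siS_scale HB _ (e_L2 k)).
Qed.

Lemma partial_sum_sqr (c : nat -> R) m :
  inner (\sum_(k < m) c k *: e k) (\sum_(k < m) c k *: e k) = \sum_(k < m) c k ^+ 2.
Proof.
have := si_sum_expand HB c m e_L2 e_orth (semi_inner0 HB).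
rewrite subr0 => ->; rewrite (si0l HB (semi_inner0 HB)) addr0.
rewrite [X in _ - _ * X]big1 ?mulr0 ?subr0; last first.
  by move=> k _; rewrite (semi_innerC HB (e_L2 k) (semi_inner0 HB)) (si0l HB (e_L2 k)) mulr0.
by apply: eq_bigr => k _; rewrite mulr1.
Qed.

Lemma eigen_expansion (c : nat -> R) z : L2 z ->
  normL 2 (\sum_(k < m) c k *: e k - z) @[m --> \oo] --> 0%E ->
  \sum_(k < m) c k ^+ 2 @[m --> \oo] --> inner z z.
Proof.
move=> Lz.
have LB m : L2 (\sum_(k < m) c k *: e k - z) by exact: (siS_sub HB (partial_sum_L2 c m) Lz).
under eq_fun do rewrite normL2E//.
move=> /cvg_EFinP h.
have LP : \forall m \near \oo, L2 (\sum_(k < m) c k *: e k).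
  by apply: nearW => m; exact: partial_sum_L2.
have {}h : N (\sum_(k < m) c k *: e k) @[m --> \oo] --> N z.
  exact: (cvg_semi_norm HB LP Lz h).
have -> : (fun m => \sum_(k < m) c k ^+ 2) =
    (fun m => N (\sum_(k < m) c k *: e k) * N (\sum_(k < m) c k *: e k)).
  by apply/funext => m; rewrite -expr2 (semi_norm_sqr HB (partial_sum_L2 c m)) partial_sum_sqr.
by rewrite -(semi_norm_sqr HB Lz) expr2; exact: (cvgM h h).
Qed.

Lemma eigen_series (c : nat -> R) z : L2 z ->
  normL 2 (\sum_(k < m) c k *: e k - z) @[m --> \oo] --> 0%E ->
  (\sum_(0 <= k <oo) (c k ^+ 2)%:E = (inner z z)%:E)%E.
Proof.
by move=> Lz h; apply: cvg_nneseries => [k|]; [exact: sqr_ge0|exact: eigen_expansion].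
Qed.

Lemma parseval v : L2 v ->
  (\sum_(0 <= k <oo) (inner v (e k) ^+ 2)%:E = (inner v v)%:E)%E.
Proof. by move=> Lv; apply: eigen_series => //; case: DE => _ _ _ _; exact. Qed.

(** [powA] is chosen among the limits of an eigenfunction series; completeness of L^2 is used here
    to provide such a limit on the whole domain. *)
Lemma riesz_fischer (c : nat -> R) : (\sum_(0 <= k <oo) (c k ^+ 2)%:E < +oo)%E ->
  exists z, L2 z /\ normL 2 (\sum_(k < m) c k *: e k - z) @[m --> \oo] --> 0%E.
Proof.
move=> coo.
pose P m := \sum_(k < m) c k *: e k.
pose S m := \sum_(k < m) c k ^+ 2.
have LP m : L2 (P m) by exact: partial_sum_L2.
have cS : cvgn S.
  apply: nondecreasing_is_cvgn.
    by apply/nondecreasing_seqP => k; rewrite /S big_ord_recr/= lerDl sqr_ge0.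
  exists (fine (\sum_(0 <= k <oo) (c k ^+ 2)%:E)%E) => _ [m _ <-].
  rewrite -lee_fin fineK; last first.
    by rewrite ge0_fin_numE ?nneseries_ge0// => k _ _; rewrite lee_fin sqr_ge0.
  rewrite -sumEFin -(big_mkord xpredT (fun k => (c k ^+ 2)%:E)).
  by apply: nneseries_lim_ge => k _ _; rewrite lee_fin sqr_ge0.
(* By orthonormality the squared distance of two partial sums is the block of squared coefficients
   between them, so [P] inherits the Cauchy property of the convergent sums [S]. *)
have innerB m k : (m <= k)%N -> inner (P m - P k) (P m - P k) = S k - S m.
  move=> mk; rewrite /P (si_sum_expand HB c m e_L2 e_orth (LP k)).
  rewrite /P partial_sum_sqr.
  have -> : \sum_(i < m) c i * inner (e i) (\sum_(j < k) c j *: e j) = S m.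
    apply: eq_bigr => i _; rewrite expr2; congr (_ * _).
    rewrite (semi_innerC HB (e_L2 i) (LP k)).
    have Lce j : L2 (c j *: e j) by exact: (siS_scale HB _ (e_L2 j)).
    rewrite (si_suml HB k Lce (e_L2 i)).
    have ik : (i < k)%N by exact: leq_trans mk.
    rewrite (bigD1 (Ordinal ik))//= (siZl HB _ (e_L2 i) (e_L2 i)) e_orth eqxx !mulr1.
    rewrite big1 ?addr0// => j ji; rewrite (siZl HB _ (e_L2 j) (e_L2 i)) e_orth.
    by rewrite (_ : (j == i :> nat) = false) ?mulr0//; apply: negbTE; apply: contra ji.
  under eq_bigr do rewrite mulr1.
  by rewrite -/(S m) -/(S k); ring.
have [z [Lz hz z0]] : exists z, [/\ l2set mu z,
    semi_norm (ip mu) (P m \_ Omega - z) @[m --> \oo] --> 0 &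
    forall x, (forall m, (P m \_ Omega) x = 0) -> z x = 0].
  apply: l2_complete => [m|d d0]; first exact: LP.
  have d20 : 0 < d / 2 by rewrite divr_gt0.
  have /cvgrPdist_le /(_ _ d20)[M _ HM] := cS.
  have patchB m k : P m \_ Omega - P k \_ Omega = (P m - P k) \_ Omega.
    by rewrite -scaleN1r addrC -patch_lin scaleN1r addrC.
  exists M => m k Mm Mk; rewrite patchB -innerE.
  have close : `|S m - S k| <= d.
    have := HM _ Mm; have := HM _ Mk => /=; rewrite !ler_norml; lra.
  have [mk|/ltnW km] := leqP m k.
    rewrite innerB//; apply: le_trans close; rewrite distrC; exact: ler_norm.
  have -> : inner (P m - P k) (P m - P k) = inner (P k - P m) (P k - P m).
    have Lkm : L2 (P k - P m) by exact: (siS_sub HB (LP k) (LP m)).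
    rewrite -[P m - P k]opprB (siNl HB Lkm (siS_opp HB Lkm)).
    by rewrite (semi_innerC HB Lkm (siS_opp HB Lkm)) (siNl HB Lkm Lkm) opprK.
  by rewrite innerB//; apply: le_trans close; exact: ler_norm.
(* All restricted partial sums vanish outside [Omega], hence so does the limit [z]. *)
have zO : z \_ Omega = z.
  apply/funext => x; rewrite /patch; case: ifPn => // xO; apply/esym/z0 => m.
  by rewrite /patch (negPf xO).
exists z; split; first by rewrite /Defs.L2 zO.
have -> : (fun m => normL 2 (P m - z)) =
    (fun m => (semi_norm (ip mu) (P m \_ Omega - z))%:E).
  apply/funext => m; rewrite /Defs.normL.
  have -> : (P m - z) \_ Omega = P m \_ Omega - z.
    by rewrite -{2}zO -scaleN1r addrC patch_lin scaleN1r addrC.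
  by rewrite Lnorm2E//; exact: (siS_sub (l2_semi_inner mu) (LP m) Lz).
exact/cvg_EFinP.
Qed.

(** The squared norm of [A^s v] read off the coefficients. Unlike the chosen function [powA], it is
    a countable sum of explicit nonnegative terms, which can be measured, integrated in time and
    estimated term by term. *)
Definition powA_sqr s v : \bar R :=
  (\sum_(0 <= k <oo) (lam k `^ (2 * s) * inner v (e k) ^+ 2)%:E)%E.

Lemma powA_coef s v k :
  lam k `^ (2 * s) * inner v (e k) ^+ 2 = (lam k `^ s * inner v (e k)) ^+ 2.
Proof. by rewrite exprMn -[(lam k `^ s) ^+ 2]powR_mulrn ?powR_ge0// -powRrM [2 * s]mulrC. Qed.

(** [riesz_fischer] shows that [powA] is not the default [0] of the choice; whichever limit is
    chosen, [eigen_series] determines its norm. *)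
Lemma powA_normE s v : domA Omega lam e s v ->
  L2 (powA Omega lam e s v) /\
  (normL 2 (powA Omega lam e s v) ^+ 2 = powA_sqr s v)%E.
Proof.
move=> [Lv voo]; pose c k := lam k `^ s * inner v (e k).
have cE : powA_sqr s v = (\sum_(0 <= k <oo) (c k ^+ 2)%:E)%E.
  by apply: eq_eseriesr => k _; rewrite powA_coef.
have : (\sum_(0 <= k <oo) (c k ^+ 2)%:E < +oo)%E by rewrite -cE.
move=> /riesz_fischer[z Hz].
have [Lw hw] : [set z | L2 z /\ normL 2 (\sum_(k < m) (lam k `^ s * inner v (e k)) *: e k - z)
    @[m --> \oo] --> 0%E] (powA Omega lam e s v).
  by apply: xgetPex; exists z.
split => //; rewrite cE (eigen_series Lw hw) normL2E//.
by rewrite -(semi_norm_sqr HB Lw).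
Qed.

(** The Poincare inequality for [A^s]: the smallest eigenvalue is factored out of the series and
    Parseval does the rest. It makes [A^s] injective and gives the value of [S] for [q = 2]. *)
Lemma powA_sqr_ge_lam0 s v : L2 v -> 0 <= s ->
  ((lam 0%N `^ (2 * s) * inner v v)%:E <= powA_sqr s v)%E.
Proof.
move=> Lv s0; rewrite EFinM -parseval// -nneseriesZl; last first.
  by move=> k _; rewrite lee_fin sqr_ge0.
apply: lee_nneseries => [k _ _|k _].
  by rewrite -EFinM lee_fin mulr_ge0 ?powR_ge0 ?sqr_ge0.
rewrite -EFinM lee_fin ler_wpM2r ?sqr_ge0//.
apply: ge0_ler_powR; rewrite ?nnegrE ?mulr_ge0 ?(ltW (lam_gt0 _))//.
by case: DE => _ lm _ _ _; exact: lm.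
Qed.

(** The weak eigenvalue equation makes the gradients of the eigenfunctions orthogonal with weights
    [lam], and gives [grad v] the same coefficients in that system as [v] has in L^2. *)
Lemma grad_bessel v m : H01 v ->
  \sum_(k < m) inner v (e k) ^+ 2 * lam k <= innerV (grad v) (grad v).
Proof.
move=> Hv; have HV := innerV_semi_inner Omega.
have ge k : forall i, L2 (grad (e k) i) by exact: grad_L2 (e_H01 k).
have ee j k : innerV (grad (e j)) (grad (e k)) = lam j * (j == k)%:R.
  by rewrite (eigen_weak _ (e_H01 k)) e_orth mul1r.
apply: (si_bessel HV (c := fun k => inner v (e k)) m ge ee (grad_L2 Hv)) => k.
rewrite eigen_weak//; congr (_ * _).
exact: (semi_innerC HB (e_L2 k) (H01_L2 Hv)).
Qed.

(** For [0 <= 2 * s <= 1] one has [lam k ^ (2 * s) <= 1 + lam k]; the two resulting sums are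
    controlled by Parseval for [v] and by Bessel for [grad v]. *)
Lemma H01_domA (s : R) v : 0 <= s <= 2^-1 -> H01 v -> domA Omega lam e s v.
Proof.
move=> /andP[s0 s1] Hv; have Lv := H01_L2 Hv; split => //.
apply: (@le_lt_trans _ _ (inner v v + innerV (grad v) (grad v))%:E); last exact: ltry.
have nn k : (0 <= (lam k `^ (2 * s) * inner v (e k) ^+ 2)%:E)%E.
  by rewrite lee_fin mulr_ge0 ?powR_ge0 ?sqr_ge0.
apply: lime_le; first by apply: is_cvg_nneseries => k _ _; exact: nn.
apply: nearW => m; rewrite big_mkord sumEFin lee_fin.
apply: (@le_trans _ _ (\sum_(k < m) (inner v (e k) ^+ 2 + inner v (e k) ^+ 2 * lam k))).
  apply: ler_sum => k _; rewrite mulrC -[X in _ <= X + _]mulr1 -mulrDr.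
  rewrite ler_wpM2l ?sqr_ge0//; have l0 := lam_gt0 k.
  have [l1|l1] := leP 1 (lam k).
    apply: (@le_trans _ _ (lam k)); last by rewrite lerDr.
    by rewrite -[leRHS]powRr1 ?(ltW l0)// ler_powR//; lra.
  apply: (@le_trans _ _ 1); last by rewrite lerDl ltW.
  suff : lam k `^ (2 * s) <= 1 `^ (2 * s) by rewrite powR1.
  by apply: ge0_ler_powR; rewrite ?nnegrE ?mulr_ge0 ?(ltW l0) ?(ltW l1).
rewrite big_split/= lerD ?grad_bessel//.
rewrite -lee_fin -parseval// -sumEFin -(big_mkord xpredT (fun k => (inner v (e k) ^+ 2)%:E)).
by apply: nneseries_lim_ge => k _ _; rewrite lee_fin sqr_ge0.
Qed.

(** By Cauchy-Schwarz [v] is orthogonal in gradient to every eigenfunction; dividing by [lam k > 0],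
    all its L^2 coefficients vanish. *)
Lemma grad_eq0 v : H01 v -> innerV (grad v) (grad v) = 0 -> is_zero Omega v.
Proof.
move=> Hv g0; have Lv := H01_L2 Hv; apply/(is_zeroP Lv)/EFin_inj.
rewrite -parseval//; apply: eseries0 => k _ _; congr EFin.
apply/eqP; rewrite sqrf_eq0; apply/eqP.
have [HV gv gk] : [/\ semi_inner [set g | forall i, L2 (g i)] innerV,
    forall i, L2 (grad v i) & forall i, L2 (grad (e k) i)].
  by split; [exact: innerV_semi_inner|exact: grad_L2|exact: grad_L2 (e_H01 k)].
have := si_CS HV gk gv; rewrite [X in _ * X]/semi_norm g0 sqrtr0 mulr0 normr_le0.
rewrite eigen_weak//.
rewrite mulf_eq0 gt_eqF ?lam_gt0//= => /eqP <-.
exact: (semi_innerC HB Lv (e_L2 k)).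
Qed.

End dirichlet.

(** * The constants S and B, and the potential energy *)

Lemma qexp_conj (R : realType) (n : nat) (theta : R) : 0 <= theta <= 1 ->
  [/\ 0 < @qexp R n theta, 0 < @qexp' R n theta &
    (@qexp' R n theta)^-1 + (@qexp R n theta)^-1 = 1].
Proof.
move=> /andP[t0 t1]; rewrite /qexp /qexp'; case: ifPn => [_|].
  by split => //; rewrite -[RHS](@divff _ 2)// [RHS]mulrDl !div1r.
rewrite -ltnNge => n2; have : 3%:R <= n%:R :> R by rewrite ler_nat.
move: n%:R => m m3; have h1 : 0 < m - 2 * theta by lra.
have h2 : 0 < m + 2 * theta by lra.
have m0 : 0 < 2 * m by lra.
split; [by rewrite divr_gt0|by rewrite divr_gt0|].
by field; rewrite !gt_eqF//; lra.
Qed.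

Section embeddings.
Context {R : realType} {n : nat} (Omega : set 'rV[R]_n).
Local Notation fct := ('rV[R]_n -> R).
Local Notation mu := (@lebesgue_rV R n).
Local Notation L2 := (L2 Omega).
Local Notation inner := (inner Omega).
Local Notation innerV := (innerV Omega).
Local Notation H01 := (H01 Omega).
Local Notation grad := (grad Omega).
Local Notation normL := (normL Omega).
Local Notation normV := (normV Omega).
Local Notation N := (semi_norm inner).
Implicit Types (u v w : fct).

Lemma normL_ge0 q v : (0 <= normL q v)%E.
Proof. exact: Lnorm_ge0. Qed.

Lemma normL_eq0 q v : 0 < q -> is_zero Omega v -> normL q v = 0%E.
Proof.
move=> q0 z; apply/eqP; rewrite eq_le normL_ge0 andbT /Defs.normL unlock.
rewrite -[leRHS](poweR0r (r := q^-1)) ?invr_neq0 ?gt_eqF//.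
rewrite gt0_ler_poweR ?invr_ge0 ?(ltW q0)//.
- by rewrite in_itv/= leey andbT integral_ge0.
- by rewrite in_itv/= leey lexx.
rewrite -(integral0 mu setT); apply: ae_le_integral => // [x _|]; first exact: poweR_ge0.
apply: filterS z => x /= zx _; rewrite /patch; case: ifPn => [/set_mem/zx ->|_];
  by rewrite normr0 powR0// gt_eqF.
Qed.

Lemma normL_gt0 q v : 0 < q -> L2 v -> ~ is_zero Omega v -> (0 < normL q v)%E.
Proof.
move=> q0 Lv nz; rewrite lt_neqAle normL_ge0 andbT eq_sym; apply/eqP => h; apply: nz.
have mv : measurable_fun setT (EFin \o v \_ Omega).
  by apply/measurable_EFinP; exact: (l2_measurable Lv).
have := Lnorm_eq0_eq0 mv (_ : 0 < q%:E)%E h; rewrite lte_fin => /(_ q0).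
by apply: filterS => x /(_ I) /= + Ox; rewrite patchE mem_set// => -[].
Qed.

Section constants.
Variables (lam : nat -> R) (e : nat -> fct) (theta p : R).
Hypothesis DE : dirichlet_eigenpairs Omega lam e.
Hypotheses (theta01 : 0 <= theta <= 1) (p1 : 1 < p).
Local Notation Ahalf := (powA Omega lam e (theta / 2)).
Local Notation domAhalf := (domA Omega lam e (theta / 2)).
Local Notation q := (@qexp R n theta).
Local Notation q' := (@qexp' R n theta).
Let HB := L2_semi_inner Omega.

Let t2 : 0 <= theta / 2 <= 2^-1.
Proof. by move: theta01 => /andP[? ?]; apply/andP; split; lra. Qed.

Lemma inner_gt0 v : L2 v -> ~ is_zero Omega v -> 0 < inner v v.
Proof.
move=> Lv nz; rewrite lt_neqAle (semi_inner_ge0 HB Lv) andbT eq_sym.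
by apply/eqP => h; apply: nz; apply/(is_zeroP Lv).
Qed.

(** The denominators in [Sconst] are positive reals, so the quotients can be multiplied out;
    positivity comes from the lowest eigenvalue. *)
Lemma Ahalf_norm v : domAhalf v -> ~ is_zero Omega v ->
  exists2 r, 0 < r & normL 2 (Ahalf v) = r%:E.
Proof.
move=> dv nz; have Lv := dv.1; have [LA AE] := powA_normE DE dv.
exists (N (Ahalf v)); last by rewrite normL2E.
rewrite lt_neqAle semi_norm_ge0 andbT eq_sym; apply/eqP => h.
have : ((lam 0%N `^ (2 * (theta / 2)) * inner v v)%:E <= 0)%E.
  have /andP[t20 _] := t2; apply: le_trans (powA_sqr_ge_lam0 DE Lv t20) _.
  by rewrite -AE normL2E// h expe2 mul0e.
rewrite lee_fin leNgt => /negP; apply.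
by rewrite mulr_gt0 ?powR_gt0 ?inner_gt0//; exact: lam_gt0 DE 0%N.
Qed.

Lemma grad_norm v : H01 v -> ~ is_zero Omega v ->
  exists2 r, 0 < r & normV (grad v) = r%:E.
Proof.
move=> Hv nz; have gL := grad_L2 Hv.
exists (semi_norm innerV (grad v)); last by rewrite normVE.
rewrite lt_neqAle semi_norm_ge0 andbT eq_sym; apply/eqP => h; apply: nz.
apply: (grad_eq0 DE Hv).
by rewrite -(semi_norm_sqr (innerV_semi_inner Omega) gL) h expr0n.
Qed.

Lemma e0_neq0 : ~ is_zero Omega (e 0%N).
Proof.
move=> /(is_zeroP (e_L2 DE 0%N)); rewrite (e_orth DE) eqxx mulr1.
by move/eqP; rewrite oner_eq0.
Qed.

Let ratio_gt0 (x : \bar R) (r : R) : (0 < x)%E -> 0 < r -> (0 < x / r%:E)%E.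
Proof.
by move=> x0 r0; rewrite mule_gt0// inver gt_eqF// lte_fin invr_gt0.
Qed.

(** The first eigenfunction is an admissible competitor, so the supremum is not over the empty set.
    Strict positivity later rules out products of [0] and [+oo]. *)
Lemma Sconst_gt0 : (0 < Sconst Omega lam e theta)%E.
Proof.
have [q0 _ _] := qexp_conj n theta01.
have d0 : domAhalf (e 0%N) by apply: (H01_domA DE t2); exact: e_H01 DE 0%N.
have [r r0 rE] := Ahalf_norm d0 e0_neq0.
apply: lt_le_trans (ereal_sup_ubound _); last by exists (e 0%N) => //; split=> //; exact: e0_neq0.
by rewrite rE; apply: ratio_gt0 => //; apply: normL_gt0 => //; [exact: d0.1|exact: e0_neq0].
Qed.

Lemma Bconst_gt0 : (0 < Bconst Omega theta p)%E.
Proof.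
have [_ q0 _] := qexp_conj n theta01.
have pq0 : 0 < p * q' by rewrite mulr_gt0//; apply: lt_trans p1.
have [r r0 rE] := grad_norm (e_H01 DE 0%N) e0_neq0.
apply: lt_le_trans (ereal_sup_ubound _); last first.
  by exists (e 0%N) => //; split; [exact: e_H01 DE 0%N|exact: e0_neq0].
rewrite rE; apply: ratio_gt0 => //; apply: normL_gt0 => //; [exact: e_L2 DE 0%N|exact: e0_neq0].
Qed.

Lemma Sconst_le (S : R) v : Sconst Omega lam e theta = S%:E -> domAhalf v ->
  (normL q v <= S%:E * normL 2 (Ahalf v))%E.
Proof.
move=> SE dv; have [q0 _ _] := qexp_conj n theta01.
have S0 : (0 < S%:E)%E by rewrite -SE; exact: Sconst_gt0.
have [z|nz] := pselect (is_zero Omega v).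
  by rewrite normL_eq0// mule_ge0 ?normL_ge0// ltW.
have [r r0 rE] := Ahalf_norm dv nz.
have : (normL q v / r%:E <= S%:E)%E.
  by rewrite -SE -rE; apply: ereal_sup_ubound; exists v.
by rewrite rE inver gt_eqF// lee_pdivrMr.
Qed.

Lemma Bconst_le (B : R) v : Bconst Omega theta p = B%:E -> H01 v ->
  (normL (p * q') v <= B%:E * normV (grad v))%E.
Proof.
move=> BE Hv; have [_ q0 _] := qexp_conj n theta01.
have pq0 : 0 < p * q' by rewrite mulr_gt0//; apply: lt_trans p1.
have B0 : (0 < B%:E)%E by rewrite -BE; exact: Bconst_gt0.
have [z|nz] := pselect (is_zero Omega v).
  by rewrite normL_eq0// mule_ge0 ?normL_ge0// ltW.
have [r r0 rE] := grad_norm Hv nz.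
have : (normL (p * q') v / r%:E <= B%:E)%E.
  by rewrite -BE -rE; apply: ereal_sup_ubound; exists v.
by rewrite rE inver gt_eqF// lee_pdivrMr.
Qed.

Definition potential v : \bar R := (\int[mu]_x (`|(v \_ Omega) x| `^ (p + 1))%:E)%E.

Lemma potentialE v : (normL (p + 1) v `^ (p + 1) = potential v)%E.
Proof.
rewrite /Defs.normL powR_Lnorm//; last by rewrite gt_eqF// addr_gt0//; apply: lt_trans p1.
Qed.

(** The origin of the exponent [p * q'] in [Bconst]: it is what Hoelder's inequality leaves of the
    factor [|v|^p]. *)
Lemma normL_powR v : (normL q' (fun x => `|v x| `^ p)%R = normL (p * q') v `^ p)%E.
Proof.
have [_ q0 _] := qexp_conj n theta01; have p0 : 0 < p by apply: lt_trans p1.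
rewrite /Defs.normL unlock -poweRrM.
have -> : (p * q')^-1 * p = q'^-1 by rewrite invfM mulrC mulrA divff ?gt_eqF// mul1r.
apply: (congr1 (fun z => poweR z _)).
apply: eq_integral => x _ /=.
congr EFin; rewrite /patch.
case: ifPn => _; first by rewrite ger0_norm ?powR_ge0// powRrM.
by rewrite normr0 !powR0// gt_eqF// mulr_gt0.
Qed.

(** Integrated form of [powR_norm_convex]. It is written additively in the extended reals because
    the finiteness of the potentials is itself derived from it. *)
Lemma potential_le v w : L2 v -> L2 w ->
  (potential v <= potential w +
    (p + 1)%:E * (normL (p * q') v `^ p * normL q (v - w)%R))%E.
Proof.
move=> Lv Lw; have [q0 q'0 qq] := qexp_conj n theta01.
have p0 : 0 < p by apply: lt_trans p1.
have mv := l2_measurable Lv; have mw := l2_measurable Lw.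
have Lvw : L2 (v - w) by exact: (siS_sub HB Lv Lw).
have mvw := l2_measurable Lvw.
have mpow (f : 'rV[R]_n -> R) r : measurable_fun setT f -> measurable_fun setT (fun x => `|f x| `^ r).
  move=> mf; apply: (measurableT_comp (measurable_powR _)).
  exact: measurableT_comp.
pose g x := `|(v \_ Omega) x| `^ p * `|((v - w) \_ Omega) x|.
have mg : measurable_fun setT g.
  by apply: measurable_funM; [exact: mpow|exact: measurableT_comp].
have g0 x : 0 <= g x by rewrite mulr_ge0 ?powR_ge0.
have p10 : 0 <= p + 1 by rewrite addr_ge0// ltW.
apply: (@le_trans _ _ (\int[mu]_x ((`|(w \_ Omega) x| `^ (p + 1))%:E + ((p + 1) * g x)%:E))%E).
  apply: ge0_le_integral => //.
  - by apply/measurable_EFinP; exact: mpow.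
  - by apply: emeasurable_funD; apply/measurable_EFinP; [exact: mpow|exact: measurable_funM].
  - move=> x _; rewrite -EFinD lee_fin /g /patch !fctE; case: ifPn => _.
      exact: powR_norm_convex.
    by rewrite !normr0 powR0 ?gt_eqF ?addr_gt0// add0r mulr0 mulr0.
rewrite ge0_integralD//; last 3 first.
- by apply/measurable_EFinP; exact: mpow.
- by move=> x _; rewrite lee_fin mulr_ge0.
- by apply/measurable_EFinP; exact: measurable_funM.
rewrite leeD2l//; under eq_integral do rewrite EFinM.
rewrite ge0_integralZl_EFin//; last 2 first.
- by move=> x _; rewrite lee_fin.
- by apply/measurable_EFinP.
rewrite lee_wpmul2l// -normL_powR.
have := hoelder mu (mpow _ p mv) mvw q'0 q0 qq.
rewrite Lnorm1 => H.
apply: le_trans (le_trans _ H) _.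
  rewrite le_eqVlt; apply/orP; left; apply/eqP; apply: eq_integral => x _.
  by rewrite /g /= normrM (ger0_norm (powR_ge0 _ _)).
rewrite le_eqVlt; apply/orP; left; apply/eqP; congr (_ * _)%E.
apply: eq_Lnorm => x /=; congr EFin; rewrite /patch; case: ifPn => // _.
by rewrite normr0 powR0// gt_eqF.
Qed.

End constants.
End embeddings.

(** * Time increments *)

Lemma is_derive_quotient (R : realType) (f : R -> R) (r l : R) :
  (y - r)^-1 * (f y - f r) @[y --> r^'] --> l -> is_derive r 1 f l.
Proof.
move=> Q.
have h : k^-1 *: ((f \o shift r) (k *: 1) - f r) @[k --> 0^'] --> l.
  apply/cvgrPdist_le => e e0; move/cvgrPdist_le : Q => /(_ e e0).
  move=> /nbhs_ballP[d /= d0 Hd]; apply/nbhs_ballP; exists d => //= k.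
  rewrite /ball/= sub0r normrN => kd k0.
  have := Hd (k + r); rewrite /ball/= opprD addrCA subrr addr0 normrN => /(_ kd).
  rewrite addrK -subr_eq0 addrK => /(_ k0) /=.
  by rewrite [k *: 1]mulr1.
by apply: DeriveDef; [apply/cvg_ex; exists l|exact: cvg_lim].
Qed.

(* With [m] the mean slope of [f], [F' = 2 m g - m^2 <= g^2]. *)
Lemma sqr_increment_le (R : realType) (f g : R -> R) (s t : R) : s < t ->
  {within `[s, t], continuous f} -> {within `[s, t], continuous g} ->
  (forall r, s < r < t -> is_derive r 1 f (g r)) ->
  (((f t - f s) ^+ 2)%:E <=
    (t - s)%:E * \int[lebesgue_measure]_(r in `[s, t]) (g r ^+ 2)%:E)%E.
Proof.
move=> st cf cg df.
have ts : 0 < t - s by rewrite subr_gt0.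
pose m := (f t - f s) / (t - s).
pose F r := 2 * m * f r - m ^+ 2 * r.
pose G r := 2 * m * g r - m ^+ 2.
have cG : {within `[s, t], continuous G}.
  by move=> x; apply: cvgB; [apply: cvgM; [exact: cvg_cst|exact: cg]|exact: cvg_cst].
have cF : {within `[s, t], continuous F}.
  move=> x; apply: cvgB; first by apply: cvgM; [exact: cvg_cst|exact: cf].
  apply: cvgM; first exact: cvg_cst.
  exact: (continuous_subspaceT (fun _ => cvg_id)).
have dF r : s < r < t -> is_derive r 1 F (G r).
  move=> /df dfr; rewrite /F /G -[X in _ - X]mulr1.
  by apply: is_deriveB.
have iG : (\int[lebesgue_measure]_(r in `[s, t]) (G r)%:E = (F t)%:E - (F s)%:E)%E.
  apply: continuous_FTC2 => //.
  - move: (cF) => /(continuous_within_itvP _ st)[_ Fs Ft].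
    split; [|exact: Fs|exact: Ft].
    by move=> r; rewrite in_itv/= => /dF[].
  - by move=> r; rewrite in_itv/= => /dF dFr; rewrite derive1E; exact: derive_val.
have cg2 : {within `[s, t], continuous (fun r => g r ^+ 2)}.
  by move=> x; apply: cvgM; exact: cg.
(* The constant [m] is the mean slope, so [F t - F s = 2 m (f t - f s) - m^2 (t - s) = (f t - f s)^2
   / (t - s)]. *)
have -> : (f t - f s) ^+ 2 = (t - s) * (F t - F s).
  by rewrite /F /m; field; rewrite gt_eqF.
rewrite EFinM lee_wpmul2l ?lee_fin ?(ltW ts)// EFinB -iG.
apply: le_integral; first exact: measurable_itv.
- exact: (continuous_compact_integrable (@segment_compact _ _ _) cG).
- exact: (continuous_compact_integrable (@segment_compact _ _ _) cg2).
- move=> x _; rewrite lee_fin /G.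
  have : 0 <= (g x - m) ^+ 2 by rewrite sqr_ge0.
  by rewrite sqrrB -mulr_natl; lra.
Qed.

Section time.
Context {R : realType} {n : nat} (Omega : set 'rV[R]_n).
Local Notation fct := ('rV[R]_n -> R).
Local Notation leb := (@lebesgue_measure R).
Local Notation L2 := (L2 Omega).
Local Notation inner := (inner Omega).
Local Notation normL := (normL Omega).
Local Notation N := (semi_norm inner).
Variables (T : \bar R) (u ut : R -> fct).
Let HB := L2_semi_inner Omega.

Lemma time_itv_le (s t : R) : 0 <= s -> s <= t -> time_itv T t -> time_itv T s.
Proof. by move=> s0 st [t0 tT]; split => //; apply: le_lt_trans tT; rewrite lee_fin. Qed.

Lemma sub_time_itv (s t : R) : 0 <= s -> time_itv T t -> `[s, t]%classic `<=` time_itv T.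
Proof.
move=> s0 tT r /=; rewrite in_itv/= => /andP[sr rt].
by apply: (time_itv_le _ rt) => //; exact: le_trans sr.
Qed.

Lemma near_time_itv t : 0 < t -> (t%:E < T)%E -> \forall r \near t, time_itv T r.
Proof.
move=> t0 tT; have [t' tt' t'T] : exists2 t', t < t' & (t'%:E <= T)%E.
  case: T tT => [T'| |] //; first by rewrite lte_fin => tT'; exists T'.
  by move=> _; exists (t + 1); rewrite ?ltrDl// leey.
near=> r; split; first by apply: ltW; near: r; exact: lt_nbhsr.
apply: lt_le_trans t'T; rewrite lte_fin; near: r; exact: lt_nbhsl.
Unshelve. all: by end_near. Qed.

Hypothesis C1 : C1_L2 Omega T u ut.

Lemma ut_L2 t : time_itv T t -> L2 (ut t). Proof. by move=> /C1[]. Qed.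
Lemma u_L2 t : time_itv T t -> L2 (u t). Proof. by move=> /C1[]. Qed.

Let cvg_real (F : set_system R) (FF : Filter F) (x : R -> fct) (y : fct) :
  (\forall r \near F, L2 (x r - y)) ->
  normL 2 (x r - y) @[r --> F] --> 0%E -> N (x r - y) @[r --> F] --> 0.
Proof.
move=> Lx h; apply/cvg_EFinP; apply: cvg_trans h; apply: near_eq_cvg.
by apply: filterS Lx => r Lr; rewrite normL2E.
Qed.

(** Pairing with a fixed [w] reduces calculus of L^2-valued maps to that of real functions, to which
    the fundamental theorem of calculus applies; [w] will be an eigenfunction. *)
Lemma inner_ut_cvg w t : L2 w -> time_itv T t ->
  inner (ut r) w @[r --> within (time_itv T) (nbhs t)] --> inner (ut t) w.
Proof.
move=> Lw tT; have [_ Lt _ h] := C1 tT.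
have near_L2 : \forall r \near within (time_itv T) (nbhs t), L2 (ut r).
  by apply: filterS (withinT _ _) => r; exact: ut_L2.
apply: (cvg_semi_inner HB near_L2 Lt Lw); apply: cvg_real => //.
by apply: filterS near_L2 => r Lr; exact: (siS_sub HB).
Qed.

Lemma inner_ut_continuous w (s t : R) : L2 w -> 0 <= s -> time_itv T t ->
  {within `[s, t], continuous (fun r => inner (ut r) w)}.
Proof.
move=> Lw s0 tT; apply/subspace_continuousP => r rst.
have := inner_ut_cvg Lw (sub_time_itv s0 tT rst).
apply: cvg_trans; apply: cvg_app; exact: within_subset (sub_time_itv s0 tT).
Qed.

Lemma inner_u_quotient w t : L2 w -> time_itv T t ->
  (r - t)^-1 * (inner (u r) w - inner (u t) w) @[r --> within (time_itv T) t^']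
    --> inner (ut t) w.
Proof.
move=> Lw tT; have [Lu Lt h _] := C1 tT.
have near_L2 : \forall r \near within (time_itv T) t^', L2 ((r - t)^-1 *: (u r - u t)).
  apply: filterS (withinT _ _) => r rT.
  by apply: (siS_scale HB); apply: (siS_sub HB) => //; exact: u_L2.
have H : inner ((r - t)^-1 *: (u r - u t)) w @[r --> within (time_itv T) t^']
    --> inner (ut t) w.
  apply: (cvg_semi_inner HB near_L2 Lt Lw); apply: cvg_real => //.
  by apply: filterS near_L2 => r Lr; exact: (siS_sub HB).
apply: cvg_trans H; apply: near_eq_cvg; apply: filterS (withinT _ _) => r rT.
have Lr := u_L2 rT; have Lrt := siS_sub HB Lr Lu.
by rewrite (siZl HB _ Lrt Lw) (siBl HB Lr Lu Lw).
Qed.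

Lemma inner_u_cvg w t : L2 w -> time_itv T t ->
  inner (u r) w @[r --> within (time_itv T) (nbhs t)] --> inner (u t) w.
Proof.
move=> Lw tT; have Q := inner_u_quotient Lw tT.
(* Continuity follows from the difference quotient multiplied by [r - t]; this covers punctured
   neighbourhoods, and the point [r = t] is added afterwards. *)
have P : (r - t) * ((r - t)^-1 * (inner (u r) w - inner (u t) w))
    @[r --> within (time_itv T) t^'] --> (t - t) * inner (ut t) w.
  apply: cvgM => //; apply: cvg_within_filter; apply: cvg_within_filter.
  by apply: cvgB; [exact: cvg_id|exact: cvg_cst].
apply/cvgrPdist_le => d d0; move/cvgrPdist_le : P => /(_ d d0).
rewrite /dnbhs !near_withinE.
apply: filterS => r H rT.
have [->|rt] := eqVneq r t; first by rewrite subrr normr0 ltW.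
have := H rt rT.
by rewrite subrr mul0r sub0r mulrA divff ?subr_eq0// mul1r opprB.
Qed.

Lemma inner_u_continuous w (s t : R) : L2 w -> 0 <= s -> time_itv T t ->
  {within `[s, t], continuous (fun r => inner (u r) w)}.
Proof.
move=> Lw s0 tT; apply/subspace_continuousP => r rst.
have := inner_u_cvg Lw (sub_time_itv s0 tT rst).
apply: cvg_trans; apply: cvg_app; exact: within_subset (sub_time_itv s0 tT).
Qed.

Lemma inner_u_derive w t : L2 w -> 0 < t -> (t%:E < T)%E ->
  is_derive t 1 (fun r => inner (u r) w) (inner (ut t) w).
Proof.
move=> Lw t0 tT; apply: is_derive_quotient.
have := inner_u_quotient Lw (conj (ltW t0) tT); apply: cvg_trans; apply: cvg_app.
move=> W /= H.
have {}H : \forall r \near t, r != t -> time_itv T r -> W r.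
  by move: H; rewrite -/(\forall r \near within (time_itv T) t^', W r) /dnbhs !near_withinE.
rewrite -/(\forall r \near t^', W r) /dnbhs near_withinE.
have := near_time_itv t0 tT; move: H; apply: filterS2 => r H rT rt.
exact: H.
Qed.

Lemma inner_increment_le w (s t : R) : L2 w -> 0 <= s -> s < t -> time_itv T t ->
  ((inner (u t - u s)%R w ^+ 2)%:E <=
    (t - s)%:E * \int[leb]_(r in `[s, t]) (inner (ut r) w ^+ 2)%:E)%E.
Proof.
move=> Lw s0 st tT.
have sT : time_itv T s by exact: time_itv_le (ltW st) tT.
rewrite (siBl HB (u_L2 tT) (u_L2 sT) Lw).
apply: (sqr_increment_le (f := fun r => inner (u r) w) (g := fun r => inner (ut r) w)) => //.
- exact: inner_u_continuous.
- exact: inner_ut_continuous.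
- move=> r /andP[sr rt]; apply: inner_u_derive => //; first exact: le_lt_trans sr.
  by case: tT => _; apply: lt_trans; rewrite lte_fin.
Qed.

Section dirichlet.
Variables (lam : nat -> R) (e : nat -> fct) (sg : R).
Hypothesis DE : dirichlet_eigenpairs Omega lam e.
Local Notation asqr := (powA_sqr Omega lam e sg).

Lemma powA_sqr_measurable (s t : R) : 0 <= s -> time_itv T t ->
  measurable_fun `[s, t] (fun r => asqr (ut r)).
Proof.
move=> s0 tT; apply: ge0_emeasurable_sum => [k x _ _|k _].
  by rewrite lee_fin mulr_ge0 ?powR_ge0 ?sqr_ge0.
apply/measurable_EFinP; apply: measurable_funM => //; apply: measurable_funX.
apply: subspace_continuous_measurable_fun => //.
by apply: inner_ut_continuous => //; exact: e_L2 DE k.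
Qed.

Lemma powA_sqr_ge0 v : (0 <= asqr v)%E.
Proof.
by apply: nneseries_ge0 => k _ _; rewrite lee_fin mulr_ge0 ?powR_ge0 ?sqr_ge0.
Qed.

(** The powers of the eigenvalues do not depend on time, so the scalar bound can be weighted and
    summed over [k]; nonnegativity permits exchanging sum and integral even if they are infinite. *)
Lemma powA_sqr_increment_le (s t : R) : 0 <= s -> s < t -> time_itv T t ->
  (asqr (u t - u s)%R <= (t - s)%:E * \int[leb]_(r in `[s, t]) asqr (ut r))%E.
Proof.
move=> s0 st tT; have ts0 : 0 <= t - s by rewrite subr_ge0 ltW.
have mk k : measurable_fun `[s, t] (fun r => (inner (ut r) (e k) ^+ 2)%:E).
  apply/measurable_EFinP; apply: measurable_funX.
  apply: subspace_continuous_measurable_fun => //.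
  by apply: inner_ut_continuous => //; exact: e_L2 DE k.
have pk k : 0 <= lam k `^ (2 * sg) by rewrite powR_ge0.
rewrite integral_nneseries//; last 2 first.
- move=> k; apply/measurable_EFinP; apply: measurable_funM => //.
  by apply/measurable_EFinP; exact: mk.
- by move=> k x _; rewrite lee_fin mulr_ge0 ?sqr_ge0.
rewrite -nneseriesZl; last first.
  by move=> k _; apply: integral_ge0 => x _; rewrite lee_fin mulr_ge0 ?sqr_ge0.
apply: lee_nneseries => [k _ _|k _]; first by rewrite lee_fin mulr_ge0 ?sqr_ge0.
under eq_integral do rewrite EFinM.
rewrite ge0_integralZl_EFin//; last 2 first.
- by move=> x _; rewrite lee_fin sqr_ge0.
- exact: mk.
rewrite muleCA EFinM lee_wpmul2l ?lee_fin//.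
by apply: inner_increment_le => //; exact: e_L2 DE k.
Qed.

Lemma powA_sqr_integral_split (s t : R) : 0 <= s -> s < t -> time_itv T t ->
  (\int[leb]_(r in `[0%R, t]) asqr (ut r) =
   \int[leb]_(r in `[0%R, s]) asqr (ut r) + \int[leb]_(r in `[s, t]) asqr (ut r))%E.
Proof.
move=> s0 st tT; have mt := powA_sqr_measurable (lexx 0) tT.
rewrite -(@integral_itv_bndo_bndc _ _ s); last first.
  apply: measurable_funS mt => // x /=; rewrite !in_itv/= => /andP[-> xs].
  by rewrite (ltW (lt_trans xs st)).
have E : `[0%R, t]%classic = `[0%R, s[%classic `|` `[s, t]%classic.
  apply/seteqP; split => x /=; rewrite !in_itv/=.
    move=> /andP[x0 xt]; have [xs|sx] := ltP x s; [left|right]; exact/andP.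
  move=> [/andP[x0 xs]|/andP[sx xt]]; first by rewrite x0 (ltW (lt_trans xs st)).
  by rewrite xt (le_trans s0 sx).
rewrite E ge0_integral_setU//.
- by rewrite -E.
- by move=> x _; exact: powA_sqr_ge0.
- apply/disj_setPS => x [] /=; rewrite !in_itv/= => /andP[_ xs] /andP[sx _].
  by move: (lt_le_trans xs sx); rewrite ltxx.
Qed.

End dirichlet.

End time.

(** * The lower bound on the lifespan *)

Lemma powRN_le (R : realType) (a x y : R) : 0 < a -> 0 < x -> 0 < y ->
  (x `^ (- a) <= y `^ (- a)) = (y <= x).
Proof.
move=> a0 x0 y0; rewrite !powRN lef_pV2 ?posrE ?powR_gt0//.
apply/idP/idP => h; last by apply: ge0_ler_powR; rewrite ?nnegrE ?(ltW a0) ?(ltW x0) ?(ltW y0).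
rewrite leNgt; apply/negP => xy; move: h; rewrite leNgt => /negP; apply.
by apply: gt0_ltr_powR; rewrite ?nnegrE ?(ltW x0) ?(ltW y0).
Qed.

Lemma limf_esup_at_left_bounded (R : realType) (f : R -> \bar R) (a b M : R) :
  a < b -> (forall t, a < t < b -> (f t <= M%:E)%E) ->
  (limf_esup f (at_left b) < +oo)%E.
Proof.
move=> ab fM; apply: (@le_lt_trans _ _ M%:E); last exact: ltry.
rewrite limf_esupE; apply: (@le_trans _ _ (ereal_sup (f @` `]a, b[%classic))).
  apply: ereal_inf_lbound; exists `]a, b[%classic => //.
  near=> t; rewrite /= in_itv/=; apply/andP; split.
    by near: t; exact: nbhs_left_gt.
  by near: t; exact: nbhs_left_lt.
by apply: ge_ereal_sup => _ [t /= + <-]; rewrite in_itv/= => /fM.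
Unshelve. all: by end_near. Qed.

(** Expansion of the square of [sqrt d * c - 2 * sqrt i]. Here [d] is the time step and [i] the
    dissipation over it; the remainder [c ^ 2 / 2] is the source of the factor one half in [K]. *)
Lemma young_sqrt (R : realType) (c d i : R) : 0 <= d -> 0 <= i ->
  2 * (c * Num.sqrt (d * i)) - 2 * i <= d * (c ^+ 2 / 2).
Proof.
move=> d0 i0; rewrite sqrtrM//.
rewrite -[d in leRHS](sqr_sqrtr d0) -[X in _ - 2 * X <= _](sqr_sqrtr i0).
have : 0 <= (Num.sqrt d * c - 2 * Num.sqrt i) ^+ 2 by rewrite sqr_ge0.
move: (Num.sqrt d) (Num.sqrt i) => x y.
have -> : (x * c - 2 * y) ^+ 2 = 2 * (x ^+ 2 * (c ^+ 2 / 2) -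
  (2 * (c * (x * y)) - 2 * y ^+ 2)) by field.
by rewrite pmulr_rge0// subr_ge0.
Qed.

Lemma modified_energy_ge (R : realType) (P P0 k J J0 D : R) :
  2^-1 * P - k * J + D <= 2^-1 * P0 - k * J0 ->
  P <= P0 + 2 * k * (J - J0) - 2 * D.
Proof. lra. Qed.

Lemma modified_energy_increment (R : realType) (a k jt js j0 dt ds x y : R) :
  k * (jt - js) <= x -> x - 2 * (dt - ds) <= y ->
  (a + k * (jt - j0) - 2 * dt) - (a + k * (js - j0) - 2 * ds) <= y.
Proof. lra. Qed.

Section lifespan.
Context {R : realType} {n : nat} (Omega : set 'rV[R]_n).
Local Notation fct := ('rV[R]_n -> R).
Local Notation leb := (@lebesgue_measure R).
Local Notation L2 := (L2 Omega).
Local Notation inner := (inner Omega).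
Local Notation innerV := (innerV Omega).
Local Notation H01 := (H01 Omega).
Local Notation grad := (grad Omega).
Local Notation normL := (normL Omega).
Local Notation N := (semi_norm inner).
Local Notation NV := (semi_norm innerV).
Variables (lam : nat -> R) (e : nat -> fct) (theta p : R).
Hypothesis DE : dirichlet_eigenpairs Omega lam e.
Hypotheses (theta01 : 0 <= theta <= 1) (p1 : 1 < p).
Local Notation Ahalf := (powA Omega lam e (theta / 2)).
Local Notation domAhalf := (domA Omega lam e (theta / 2)).
Local Notation asqr := (powA_sqr Omega lam e (theta / 2)).
Local Notation potential := (potential Omega p).
Let HB := L2_semi_inner Omega.
Let HV := innerV_semi_inner Omega.

Lemma PhiE v1 v0 : L2 v1 -> H01 v0 ->
  Phi Omega v1 v0 = (N v1 ^+ 2 + NV (grad v0) ^+ 2)%:E.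
Proof.
move=> L1 H0; rewrite /Phi normL2E// normVE; last exact: grad_L2.
by rewrite EFinD !EFin_expe.
Qed.

Section finite_constants.
Variables S B : R.
Hypotheses (SE : Sconst Omega lam e theta = S%:E) (BE : Bconst Omega theta p = B%:E).

Lemma S_gt0 : 0 < S.
Proof. by rewrite -lte_fin -SE; exact: Sconst_gt0. Qed.

Lemma B_gt0 : 0 < B.
Proof. by rewrite -lte_fin -BE; exact: Bconst_gt0 DE _ _. Qed.

(** The bound [d2] also places [v - w] in the domain on which the embedding with constant [S]
    holds. *)
Lemma potential_increment v w (d2 : R) : H01 v -> L2 w -> 0 <= d2 ->
  (asqr (v - w)%R <= d2%:E)%E ->
  (potential v <= potential w +
    ((p + 1) * ((B * NV (grad v)) `^ p * (S * Num.sqrt d2)))%:E)%E.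
Proof.
move=> Hv Lw d20 dle; have Lv := H01_L2 Hv.
have p0 : 0 < p by apply: lt_trans p1.
have Lvw : L2 (v - w) := siS_sub HB Lv Lw.
have dvw : domAhalf (v - w) by split => //; apply: le_lt_trans dle (ltry _).
have [LA AE] := powA_normE DE dvw.
apply: le_trans (potential_le theta01 p1 Lv Lw) _.
rewrite leeD2l// EFinM lee_wpmul2l ?lee_fin ?addr_ge0 ?(ltW p0)// EFinM.
have B0 := ltW B_gt0; have S0 := ltW S_gt0.
apply: lee_pmul; rewrite ?poweR_ge0 ?normL_ge0//.
  rewrite -poweR_EFin; apply: gt0_ler_poweR; rewrite ?(ltW p0)//.
  - by rewrite in_itv/= leey andbT normL_ge0.
  - by rewrite in_itv/= leey andbT lee_fin mulr_ge0 ?semi_norm_ge0.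
  - rewrite EFinM -normVE; last exact: grad_L2.
    exact: (Bconst_le DE theta01 p1 BE Hv).
apply: le_trans (Sconst_le DE theta01 SE dvw) _.
rewrite EFinM lee_wpmul2l ?lee_fin// normL2E// lee_fin.
rewrite -[leLHS]ger0_norm ?semi_norm_ge0// -sqrtr_sqr ler_wsqrtr//.
by rewrite -lee_fin (semi_norm_sqr HB LA); move: dle; rewrite -AE normL2E// -EFin_expe (semi_norm_sqr HB LA).
Qed.

(** Comparison with [w = 0], whose potential is [0]: finiteness of [S] and [B] thus embeds H^1_0 in
    L^(p+1). *)
Lemma potential_fin v : H01 v -> potential v \is a fin_num.
Proof.
move=> Hv; have Lv := H01_L2 Hv.
have t2 : 0 <= theta / 2 <= 2^-1 by move: theta01 => /andP[? ?]; apply/andP; split; lra.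
have [_ dv] := H01_domA DE t2 Hv.
have p10 : p + 1 != 0 by rewrite gt_eqF// addr_gt0//; apply: lt_trans p1.
have potential0 : potential 0 = 0%E.
  apply: integral0_eq => x _.
  by rewrite /patch; case: ifP; rewrite normr0 powR0.
have av_fin : asqr v \is a fin_num by rewrite ge0_fin_numE ?powA_sqr_ge0.
have := potential_increment Hv (semi_inner0 HB) (_ : 0 <= fine (asqr v)).
rewrite subr0 fineK// potential0 add0e => /(_ (fine_ge0 (powA_sqr_ge0 _ _ _ _ _)) (lexx _)) h.
rewrite ge0_fin_numE; first by apply: le_lt_trans h (ltry _).
by apply: integral_ge0 => x _; rewrite lee_fin powR_ge0.
Qed.

Variables (T : R) (u ut : R -> fct).
Local Notation TT := (time_itv T%:E).
Hypotheses (CH : C_H01 Omega T%:E u) (C1 : C1_L2 Omega T%:E u ut).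
Hypothesis ut_loc : L2loc domAhalf (fun v => normL 2 (Ahalf v)) T%:E ut.
Hypothesis energy : forall t, TT t ->
  (Energy Omega p (ut t) (u t)
    + \int[leb]_(s in `[0%R, t]) normL 2 (Ahalf (ut s)) ^+ 2
  <= Energy Omega p (ut 0%R) (u 0%R))%E.

Let P t := N (ut t) ^+ 2 + NV (grad (u t)) ^+ 2.
Let g t := NV (grad (u t)).
Let J t := fine (potential (u t)).
Let D t := fine (\int[leb]_(r in `[0%R, t]) asqr (ut r))%E.
Let K := 2^-1 * S ^+ 2 * B `^ (2 * p).

Let uH t : TT t -> H01 (u t). Proof. by move=> /CH[]. Qed.

Lemma EnergyE v1 v0 : L2 v1 -> H01 v0 -> Energy Omega p v1 v0 =
  (2^-1 * (N v1 ^+ 2 + NV (grad v0) ^+ 2) - (p + 1)^-1 * fine (potential v0))%:E.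
Proof.
move=> L1 H0; rewrite /Energy normL2E// normVE; last exact: grad_L2.
rewrite (potentialE Omega p1) -[in LHS](fineK (potential_fin H0)).
by rewrite -!EFin_expe -!EFinM mulrDr.
Qed.

(** [asqr (ut r)] is known to be the squared norm of [Ahalf (ut r)] only for almost every [r],
    namely where [ut r] lies in the domain; hence the almost everywhere comparison. *)
Lemma powA_sqr_integral_lty t : TT t -> (\int[leb]_(r in `[0%R, t]) asqr (ut r) < +oo)%E.
Proof.
move=> tT; case: ut_loc => dom _ /(_ t tT); apply: le_lt_trans.
apply: ae_le_integral => [r _|r _|]; first exact: powA_sqr_ge0.
  by rewrite expe2 mule_ge0 ?normL_ge0.
apply: (@filterS _ _ (ae_filter_ringOfSetsType leb) _ _ _ dom) => r dr rt.
by have [_ ->] := powA_normE DE (dr (sub_time_itv (lexx 0) tT rt)).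
Qed.

Let D_EFin t : TT t -> (\int[leb]_(r in `[0%R, t]) asqr (ut r))%E = (D t)%:E.
Proof.
move=> tT; rewrite fineK// ge0_fin_numE ?powA_sqr_integral_lty//.
by apply: integral_ge0 => r _; exact: powA_sqr_ge0.
Qed.

Lemma energy_le t : TT t ->
  2^-1 * P t - (p + 1)^-1 * J t + D t <= 2^-1 * P 0 - (p + 1)^-1 * J 0.
Proof.
move=> tT; have t0T : TT 0 by case: tT => t0 tT; exact: (time_itv_le (lexx 0) t0).
have := energy tT.
rewrite (EnergyE (ut_L2 C1 tT) (uH tT)) (EnergyE (ut_L2 C1 t0T) (uH t0T)).
move=> en; rewrite -lee_fin EFinD; apply: le_trans en; rewrite leeD2l// -D_EFin//.
apply: ae_le_integral => [r _|r _|]; first exact: powA_sqr_ge0.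
  by rewrite expe2 mule_ge0 ?normL_ge0.
case: ut_loc => dom _ _;
apply: (@filterS _ _ (ae_filter_ringOfSetsType leb) _ _ _ dom) => r dr rt.
by have [_ ->] := powA_normE DE (dr (sub_time_itv (lexx 0) tT rt)).
Qed.

Let H t := P 0 + 2 / (p + 1) * (J t - J 0) - 2 * D t.

Let H_ge t : TT t -> P t <= H t.
Proof. by move=> /energy_le /modified_energy_ge. Qed.

Let H0 : H 0 = P 0.
Proof.
rewrite /H subrr mulr0 addr0 /D set_itv1.
by rewrite integral_set1 mulr0 subr0.
Qed.

Let g_ge0 t : 0 <= g t. Proof. exact: semi_norm_ge0. Qed.

Let K0 : 0 <= K.
Proof. by apply: mulr_ge0 (powR_ge0 _ _); apply: mulr_ge0 (sqr_ge0 _). Qed.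

(** The right-hand side keeps the gradient [g t] instead of [H t] because it is used twice: with [g]
    bounded by continuity it bounds [H] a priori on [[0, b]], and with [g ^ 2 <= P <= H] it becomes
    the increment condition of [gronwall_power]. *)
Let H_incr s t : 0 <= s -> s <= t -> TT t ->
  H t - H s <= (t - s) * K * (g t ^+ 2) `^ p.
Proof.
move=> s0; rewrite le_eqVlt => /predU1P[<- _|st tT]; first by rewrite !subrr !mul0r.
have sT : TT s by exact: (time_itv_le s0 (ltW st)).
have p0 : 0 < p + 1 by rewrite addr_gt0//; apply: lt_trans p1.
have I0 : 0 <= D t - D s.
  rewrite subr_ge0 -lee_fin -!D_EFin// (powA_sqr_integral_split C1 _ DE s0 st tT).
  by rewrite leeDl//; apply: integral_ge0 => r _; exact: powA_sqr_ge0.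
have incr : (asqr (u t - u s)%R <= ((t - s) * (D t - D s))%:E)%E.
  apply: le_trans (powA_sqr_increment_le C1 _ DE s0 st tT) _.
  rewrite EFinM lee_wpmul2l ?lee_fin ?subr_ge0 ?(ltW st)//.
  rewrite EFinB -!D_EFin// (powA_sqr_integral_split C1 _ DE s0 st tT) D_EFin//.
  by rewrite addeAC subee ?add0e.
have ts0 : 0 <= t - s by rewrite subr_ge0 ltW.
have := potential_increment (uH tT) (u_L2 C1 sT) (mulr_ge0 ts0 I0) incr.
rewrite -(fineK (potential_fin (uH tT))) -(fineK (potential_fin (uH sT))).
rewrite -EFinD lee_fin -/(J t) -/(J s) -/(g t) => JJ.
set c := (B * g t) `^ p * S.
(* The identity that dictates [K]: half the square of [S B^p g^p]. *)
have cK : c ^+ 2 / 2 = K * (g t ^+ 2) `^ p.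
  have e1 (x : R) : (x `^ p) ^+ 2 = x `^ (2 * p).
    by rewrite -powR_mulrn ?powR_ge0// -powRrM mulrC.
  have e2 : (g t ^+ 2) `^ p = g t `^ (2 * p) by rewrite -powR_mulrn ?g_ge0// -powRrM.
  rewrite /c /K exprMn e1 e2 powRM ?g_ge0 ?(ltW B_gt0)//.
  by move: (g t `^ _) (B `^ _) => x y; field.
have Y : 2 * (c * Num.sqrt ((t - s) * (D t - D s))) - 2 * (D t - D s) <=
    (t - s) * K * (g t ^+ 2) `^ p.
  by rewrite -mulrA -cK; exact: young_sqrt.
rewrite /H; apply: modified_energy_increment Y.
rewrite mulrAC ler_pdivrMr// -mulrA ler_pM2l// lerBlDl; apply: le_trans JJ _.
by rewrite lerD2l [leRHS]mulrC /c -!mulrA.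
Qed.

Let g_bounded b : 0 <= b -> TT b -> exists M, forall t, 0 <= t <= b -> g t <= M.
Proof.
move=> b0 bT.
have cg : {within `[0, b], continuous g}.
  apply/subspace_continuousP => t tb.
  have tT := sub_time_itv (lexx 0) bT tb.
  have [Hu hu] := CH tT.
  have h : g r @[r --> within TT (nbhs t)] --> g t.
    have nL : \forall r \near within TT (nbhs t), forall i, L2 (grad (u r) i).
      by apply: filterS (withinT _ _) => r rT; exact: (grad_L2 (uH rT)).
    apply: (cvg_semi_norm HV nL (grad_L2 Hu)); apply/cvg_EFinP.
    apply: cvg_trans hu; apply: near_eq_cvg; apply: filterS nL => r Lr.
    by rewrite normVE//; exact: (siS_sub HV Lr (grad_L2 Hu)).
  apply: cvg_trans h; apply: cvg_app.
  exact: within_subset (sub_time_itv (lexx 0) bT).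
have [c _ hc] := EVT_max b0 cg.
by exists (g c) => t tb; apply: hc; rewrite in_itv.
Qed.

(* [eps] keeps the modified energy away from [0]. *)
Lemma Phi_gronwall b eps : 0 < eps -> 0 <= b -> TT b ->
  (P 0 + eps) `^ (1 - p) - (p - 1) * K * b <= (H b + eps) `^ (1 - p).
Proof.
move=> e0 b0 bT; have [M HM] := g_bounded b0 bT.
have p0 : 0 <= p by apply: ltW; apply: lt_trans p1.
have tT t : t <= b -> 0 <= t -> TT t by move=> tb t0; exact: (time_itv_le t0 tb).
have Pge t : 0 <= P t by rewrite /P addr_ge0 ?sqr_ge0.
rewrite lerBlDr -lerBlDl -H0.
apply: (gronwall_power (W := fun t => H t + eps) (c := eps)
  (M := P 0 + b * K * (M ^+ 2) `^ p + eps)) => //.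
- move=> t /andP[t0 tb]; have tTt := tT _ tb t0; apply/andP; split.
    by rewrite lerDr; exact: le_trans (H_ge tTt).
  rewrite lerD2r -lerBlDl -{1}H0; apply: le_trans (H_incr (lexx 0) t0 tTt) _.
  rewrite subr0; apply: ler_pM; [exact: mulr_ge0 t0 K0|exact: powR_ge0| |].
    exact: (ler_wpM2r K0 tb).
  have gM : g t <= M by apply: HM; rewrite t0.
  apply: ge0_ler_powR; rewrite ?nnegrE ?sqr_ge0//.
  by rewrite ler_pXn2r ?nnegrE// (le_trans (g_ge0 t)).
- move=> s t s0 st tb; have tTt := tT _ tb (le_trans s0 st).
  have -> : (H t + eps) - (H s + eps) = H t - H s.
    by rewrite opprD addrACA subrr addr0.
  apply: le_trans (H_incr s0 st tTt) _.
  apply: ler_wpM2l; first by rewrite mulr_ge0// subr_ge0.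
  have gH : g t ^+ 2 <= H t + eps.
    apply: le_trans (le_trans (H_ge tTt) _); last by rewrite lerDl ltW.
    by rewrite /P lerDr sqr_ge0.
  by apply: ge0_ler_powR; rewrite ?nnegrE ?sqr_ge0//; exact: le_trans (sqr_ge0 _) gH.
Qed.

Lemma Phi_bounded : 0 < T -> 0 < P 0 -> (p - 1) * K * T < P 0 `^ (1 - p) ->
  exists M, forall t, TT t -> (Phi Omega (ut t) (u t) <= M%:E)%E.
Proof.
move=> T0 P00 lt.
have a0 : 0 < p - 1 by rewrite subr_gt0.
have pE : 1 - p = - (p - 1) by rewrite opprB.
have KT0 : 0 <= (p - 1) * K * T by exact: mulr_ge0 (mulr_ge0 (ltW a0) K0) (ltW T0).
(* The strict gap is split at its midpoint [m]: [eps] solves [(P 0 + eps) ^ (1 - p) = m], and is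
   positive as this power is decreasing, while the other half [d] of the gap is a lower bound for
   [(H t + eps) ^ (1 - p)] that is uniform in [t < T]. *)
pose m := ((p - 1) * K * T + P 0 `^ (1 - p)) / 2.
have m1 : (p - 1) * K * T < m := (midf_lt lt).1.
have m2 : m < P 0 `^ (1 - p) := (midf_lt lt).2.
have m0 : 0 < m by exact: le_lt_trans m1.
have invK x : 0 < x -> (x `^ (1 - p)^-1) `^ (1 - p) = x.
  by move=> x0; rewrite -powRrM mulVf ?powRr1 ?(ltW x0)// subr_eq0 eq_sym gt_eqF.
pose eps := m `^ (1 - p)^-1 - P 0.
have e0 : 0 < eps.
  rewrite subr_gt0 ltNge; apply/negP.
  rewrite -(powRN_le a0) ?powR_gt0// -pE invK// => h.
  by move: (le_lt_trans h m2); rewrite ltxx.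
pose d := m - (p - 1) * K * T.
have d0 : 0 < d by rewrite subr_gt0.
exists (d `^ (1 - p)^-1) => t tT; have [t0 tlt] := tT.
rewrite PhiE; [|exact: (ut_L2 C1 tT)|exact: uH]; rewrite lee_fin -/(P t).
have Pe : P 0 + eps = m `^ (1 - p)^-1 by rewrite /eps [LHS]addrC subrK.
have := Phi_gronwall e0 t0 tT; rewrite Pe invK// => h.
have Ht : P t <= H t := H_ge tT.
have Pt0 : 0 <= P t by rewrite /P addr_ge0 ?sqr_ge0.
apply: (@le_trans _ _ (H t + eps)); first by apply: (le_trans Ht); rewrite lerDl ltW.
have He : 0 < H t + eps by rewrite ltr_wpDl// (le_trans Pt0).
rewrite -(powRN_le a0) ?powR_gt0// -pE invK//.
apply: le_trans h; rewrite /d lerD2l lerN2; apply: (ler_wpM2l (mulr_ge0 (ltW a0) K0)).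
by move: tlt; rewrite lte_fin => /ltW.
Qed.

End finite_constants.
End lifespan.

(** With [q = 2] the quotient is bounded through the lowest eigenvalue, and the first eigenfunction
    attains the bound. *)
Lemma Sconst_low_dim (R : realType) (n : nat) (Omega : set 'rV[R]_n)
    (lam : nat -> R) (e : nat -> 'rV[R]_n -> R) (theta : R) :
  (n <= 2)%N -> dirichlet_eigenpairs Omega lam e -> 0 <= theta <= 1 ->
  Sconst Omega lam e theta = (lam 0%N `^ (- (theta / 2)))%:E.
Proof.
move=> n2 DE t01; have HB := L2_semi_inner Omega.
have t20 : 0 <= theta / 2 by rewrite divr_ge0//; case/andP: t01.
have t2 : 0 <= theta / 2 <= 2^-1.
  by move: t01 => /andP[? ?]; apply/andP; split; lra.
have l0 := lam_gt0 DE 0%N.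
have lt0 : 0 < lam 0%N `^ (theta / 2) by rewrite powR_gt0.
have qE : @qexp R n theta = 2 by rewrite /qexp n2.
have l2 : lam 0%N `^ (2 * (theta / 2)) = (lam 0%N `^ (theta / 2)) ^+ 2.
  by rewrite -powR_mulrn ?powR_ge0// -powRrM mulrC.
rewrite /Sconst qE powRN; apply/eqP; rewrite eq_le; apply/andP; split.
  apply: ge_ereal_sup => _ /= [v [dv nz] <-]; have Lv := dv.1.
  have [r r0 rE] := Ahalf_norm DE t01 dv nz.
  have [LA AE] := powA_normE DE dv.
  rewrite rE inver gt_eqF// normL2E// -EFinM lee_fin ler_pdivrMr//.
  rewrite ler_pdivlMl//.
  have := powA_sqr_ge_lam0 DE Lv t20; rewrite -AE rE -EFin_expe lee_fin l2.
  rewrite -(semi_norm_sqr HB Lv) -exprMn.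
  by rewrite ler_pXn2r// nnegrE ?mulr_ge0 ?semi_norm_ge0 ?(ltW lt0) ?(ltW r0).
have d0 := H01_domA DE t2 (e_H01 DE 0%N).
have nz := e0_neq0 DE; have [r r0 rE] := Ahalf_norm DE t01 d0 nz.
have [LA AE] := powA_normE DE d0.
apply: ereal_sup_ubound; exists (e 0%N) => //; rewrite rE inver gt_eqF//.
have -> : normL Omega 2 (e 0%N) = 1%E.
  by rewrite (normL2E (e_L2 DE 0%N)) /semi_norm (e_orth DE) eqxx mulr1 sqrtr1.
rewrite mul1e.
congr (_^-1)%:E; apply/eqP; rewrite -(@eqrXn2 _ 2) ?(ltW r0) ?(ltW lt0)//.
apply/eqP/EFin_inj; rewrite EFin_expe -rE AE -l2 /powA_sqr.
transitivity (\sum_(0 <= k <oo) ((lam 0%N `^ (2 * (theta / 2)))%:E *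
    (inner Omega (e 0%N) (e k) ^+ 2)%:E))%E.
  apply: eq_eseriesr => k _; rewrite -EFinM (e_orth DE).
  by case: eqP => [<-//|_]; rewrite mulr0 expr0n !mulr0.
rewrite nneseriesZl; last by move=> k _; rewrite lee_fin sqr_ge0.
by rewrite (parseval DE (e_L2 DE 0%N)) (e_orth DE) eqxx !mulr1 mule1.
Qed.

Lemma lifespan_lower_bound (R : realType) (n : nat) (Omega : set 'rV[R]_n)
    (lam : nat -> R) (e : nat -> 'rV[R]_n -> R) (theta p : R)
    (u0 u1 : 'rV[R]_n -> R) (Tmax : \bar R) (u : R -> 'rV[R]_n -> R) :
  dirichlet_eigenpairs Omega lam e -> 0 <= theta <= 1 -> 1 < p ->
  H01 Omega u0 -> L2 Omega u1 -> ~ (is_zero Omega u0 /\ is_zero Omega u1) ->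
  energy_solution Omega lam e theta p Tmax u0 u1 u ->
  (((p - 1)%:E * Kconst Omega lam e theta p * Phi Omega u1 u0 `^ (p - 1))^-1
     <= Tmax)%E.
Proof.
move=> DE t01 p1 H0 L1 nz [ut [utt [T0 [CH C1 loc] [z0 z1 _ _ _] en blowup]]].
have p10 : 0 < p - 1 by rewrite subr_gt0.
case: Tmax => [T| |] in T0 CH C1 loc en blowup *; [|by rewrite leey|by []].
rewrite lte_fin in T0.
have T00 : time_itv T%:E (0 : R) by split => //; rewrite lte_fin.
have Hu0 : H01 Omega (u 0) by have [] := CH _ T00.
have Lut0 : L2 Omega (ut 0) := ut_L2 C1 T00.
pose P0 := semi_norm (inner Omega) (ut 0) ^+ 2 +
  semi_norm (innerV Omega) (grad Omega (u 0)) ^+ 2.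
(* The solution agrees with the data only almost everywhere at time [0]; neither term of [Phi] sees
   the difference. *)
have Phi0E : Phi Omega u1 u0 = P0%:E.
  rewrite /P0 -(PhiE Lut0 Hu0) /Phi (grad_ae (H01_L2 Hu0) (H01_L2 H0) z0).
  by rewrite (eq_normL2_ae z1).
(* If [P0] were [0], both data would vanish almost everywhere, [u0] because its gradient has norm
   [0]. *)
have P0_gt0 : 0 < P0.
  rewrite lt_neqAle eq_sym addr_ge0 ?sqr_ge0// andbT; apply/eqP => P00; apply: nz.
  have : semi_norm (inner Omega) u1 ^+ 2 +
      semi_norm (innerV Omega) (grad Omega u0) ^+ 2 == 0.
    by apply/eqP/EFin_inj; rewrite -(PhiE L1 H0) Phi0E P00.
  rewrite paddr_eq0 ?sqr_ge0// !sqrf_eq0 => /andP[/eqP N1 /eqP N0]; split.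
    apply: (grad_eq0 DE H0).
    by rewrite -(semi_norm_sqr (innerV_semi_inner Omega) (grad_L2 H0)) N0 expr0n.
  by apply/(is_zeroP L1); rewrite -(semi_norm_sqr (L2_semi_inner Omega) L1) N1 expr0n.
have S0 := Sconst_gt0 DE t01; have B0 := Bconst_gt0 DE t01 p1.
have P0p : 0 < P0 `^ (p - 1) by rewrite powR_gt0.
(* Since [P0 ^ (p - 1)] is positive the product is [+oo], and its inverse is [0] by convention. *)
have infinite : Kconst Omega lam e theta p = +oo%E ->
    (((p - 1)%:E * Kconst Omega lam e theta p * Phi Omega u1 u0 `^ (p - 1))^-1 <= T%:E)%E.
  move=> ->; rewrite Phi0E poweR_EFin gt0_muley ?lte_fin// gt0_mulye ?lte_fin//.
  by rewrite invey lee_fin ltW.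
have p20 : 2 * p != 0 by rewrite mulf_neq0// gt_eqF//; apply: lt_trans p1.
case SE : (Sconst Omega lam e theta) S0 => [S| |] //; last first.
  move=> _; apply: infinite; rewrite /Kconst SE expe2 mulyy gt0_muley ?lte_fin ?invr_gt0//.
  by rewrite gt0_mulye// poweR_gt0.
rewrite lte_fin => S0.
case BE : (Bconst Omega theta p) B0 => [B| |] //; last first.
  move=> _; apply: infinite; rewrite /Kconst SE BE poweRyr// gt0_muley//.
  by rewrite -EFin_expe -EFinM lte_fin mulr_gt0 ?invr_gt0// exprn_gt0.
rewrite lte_fin => B0.
pose K := 2^-1 * S ^+ 2 * B `^ (2 * p).
have K0 : 0 < K by rewrite /K !mulr_gt0 ?invr_gt0 ?powR_gt0// exprn_gt0.
have KE : Kconst Omega lam e theta p = K%:E.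
  by rewrite /Kconst SE BE poweR_EFin -EFin_expe -!EFinM.
have c0 : 0 < (p - 1) * K * P0 `^ (p - 1) by exact: mulr_gt0 (mulr_gt0 p10 K0) P0p.
rewrite KE Phi0E poweR_EFin -!EFinM inver gt_eqF// lee_fin leNgt; apply/negP => lt.
have lt' : (p - 1) * K * T < P0 `^ (1 - p).
  by move: lt; rewrite -[1 - p]opprB powRN invfM (ltr_pdivlMl _ _ (mulr_gt0 p10 K0)).
have [M HM] := Phi_bounded DE t01 p1 SE BE CH C1 loc en T0 P0_gt0 lt'.
case: blowup => [//|[_ /= esup]].
suff : (limf_esup (fun t => Phi Omega (ut t) (u t)) (at_left T) < +oo)%E.
  by rewrite esup ltxx.
apply: (limf_esup_at_left_bounded (M := M) T0) => t /andP[t0 tT].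
by apply: HM; split; [exact: ltW|rewrite lte_fin].
Qed.

Unset Implicit Arguments.

Theorem theorem2p4 (R : realType) (n : nat) (Omega : set 'rV[R]_n)
    (lam : nat -> R) (e : nat -> 'rV[R]_n -> R) (theta p : R)
    (u0 u1 : 'rV[R]_n -> R) (Tmax : \bar R) (u : R -> 'rV[R]_n -> R) :
  (0 < n)%N -> open Omega -> bounded_set Omega ->
  dirichlet_eigenpairs Omega lam e ->
  0 <= theta <= 1 ->
  1 < p ->
  ((2 < n)%N -> p < (n%:R + 2) / (n%:R - 2)) ->
  ((2 < n)%N -> p <= (n%:R + 2 * theta) / (n%:R - 2)) ->
  H01 Omega u0 -> L2 Omega u1 ->
  ~ (is_zero Omega u0 /\ is_zero Omega u1) ->
  energy_solution Omega lam e theta p Tmax u0 u1 u ->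
  (((p - 1)%:E * Kconst Omega lam e theta p * Phi Omega u1 u0 `^ (p - 1))^-1
     <= Tmax)%E /\
  ((n <= 2)%N -> Sconst Omega lam e theta = (lam 0%N `^ (- (theta / 2)))%:E).
Proof.
move=> _ _ _ DE t01 p1 _ _ H0 L1 nz sol; split.
  exact: lifespan_lower_bound sol.
by move=> n2; exact: Sconst_low_dim.
Qed.
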